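(* Let $k,n$ be integers with $2<k\le \frac n2$. The homogeneous coordinate ring $\mathbb{C}[\mathbb{G}(k,n)]$, with its cluster algebra structure, is a cluster algebra of finite type if and only if $(k,n)\in\{(3,6),(3,7),(3,8)\}$. That is, $\mathbb{G}(3,6)$, $\mathbb{G}(3,7)$ and $\mathbb{G}(3,8)$ are the only Grassmannians $\mathbb{G}(k,n)$ in the range $2<k\le\frac n2$ whose homogeneous coordinate rings are cluster algebras of finite type.
   Context: A cluster algebra is of finite type if it has only finitely many cluster variables. Grassmannian. $X(k,n)\subset\bigwedge^k\mathbb{C}^n$ is the affine cone of decomposable $k$-forms, with Plücker coordinates $\Delta^K$ indexed by $k$-subsets $K\subset\{1,\dots,n\}$. $\mathbb{C}[\mathbb{G}(k,n)]$ denotes the coordinate ring of $X(k,n)$. Seeds and mutation. A seed in a field $\mathcal{F}$ of rational functions over $\mathbb{C}$ in $M$ variables is a triple $(\mathbf{x},\mathbf{c},\tilde B)$ where $\tilde{\mathbf{x}}=\mathbf{x}\sqcup\mathbf{c}$ is a transcendence basis of $\mathcal{F}$ ($M$ algebraically independent elements) and $\tilde B=(b_{x,y})$ is an integer matrix with rows indexed by $\tilde{\mathbf x}$ and columns by $\mathbf{x}$ whose square submatrix with rows in $\mathbf{x}$ is skew-symmetrizable. For $z\in\mathbf{x}$, $\mu_z(\mathbf{x},\mathbf{c},\tilde B)=(\mathbf{x}-\{z\}\cup\{z'\},\mathbf{c},\tilde B')$, where $zz'=\prod_{b_{x,z}>0}x^{b_{x,z}}+\prod_{b_{x,z}<0}x^{-b_{x,z}}$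 and $b'_{x,y}=-b_{x,y}$ if $x=z$ or $y=z$, $b'_{x,y}=b_{x,y}+\frac{|b_{x,z}|b_{z,y}+b_{x,z}|b_{z,y}|}{2}$ otherwise (index $z$ renamed $z'$). Clusters are the sets $\mathbf{x}$ in seeds obtained from an initial seed by iterated mutation; their elements are the cluster variables; the cluster algebra is the $\mathbb{C}[c\mid c\in\mathbf c]$-algebra they generate. Cluster structure on $\mathbb{C}[\mathbb{G}(k,n)]$ ($n\ge k+2\ge4$). $\mathcal{F}$ is the fraction field of $\mathbb{C}[\mathbb{G}(k,n)]$. For $0\le i\le k$, $0\le j\le n-k$ put $p_{ij}=n-k-\lfloor\frac{i+j-2}{2}\rfloor$, $p'_{ij}=n-k+2+\lfloor\frac{i+j-1}{2}\rfloor$ and $I_{ij}=\{p_{ij},\dots,p_{ij}+i-1\}\sqcup\{p'_{ij},\dots,p'_{ij}+k-i-1\}$ (mod $n$; only non-corner pairs $(i,j)$ are used). The initial cluster is $\{\Delta^{I_{ij}}: 1\le i\le k-1,\ 1\le j\le n-k-1\}$; the coefficients $\mathbf{c}$ are the $\Delta^{K}$ for the $n$ cyclic intervals $K$ of length $k$ (these are the $I_{ij}$ with $i\in\{0,k\}$ or $j\in\{0,n-k\}$). In the column of $\tilde B$ indexed by $I_{ij}$ the entries in rows $I_{i\pm1,j}$ equal $(-1)^{i+j}$, the entries in rows $I_{i,j\pm1}$ equal $-(-1)^{i+j}$, and all other entries are $0$. *)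

(* Defs.v *)
From HB Require Import structures.
From mathcomp Require Import all_boot all_order all_algebra.
From mathcomp Require Import ring_quotient fraction mpoly.
From mathcomp Require Import boolp classical_sets cardinality reals.
From mathcomp.real_closed Require Import complex.

Set Implicit Arguments.
Unset Strict Implicit.
Unset Printing Implicit Defensive.

Import Order.TTheory GRing.Theory Num.Theory.

Local Open Scope ring_scope.

(* Seeds are labelled: [I] labels the cluster variables, [J] the coefficients,
   and mutation at [z] keeps the label [z] for the new variable z'. The two
   conditions imposed on a seed (the extended cluster is a transcendence basis
   of F, the principal part of the matrix is skew-symmetrizable) are inherited
   by mutation and play no role in the recursion below, so the record carries
   the triple only. *)
Record seed (F : fieldType) (I J : finType) := Seed {
  cluster : I -> F;
  coefficient : J -> F;
  exchange : I + J -> I -> int }.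

Section Mutation.
Variables (F : fieldType) (I J : finType).
Implicit Types (S : seed F I J) (z : I).

Definition extended_cluster S (r : I + J) : F :=
  match r with inl i => cluster S i | inr j => coefficient S j end.

Definition mutate S z : seed F I J :=
  let b := exchange S in
  {| cluster := fun i =>
       if i == z then
         (\prod_(r | 0 < b r z) extended_cluster S r ^+ `|b r z|%N
          + \prod_(r | b r z < 0) extended_cluster S r ^+ `|b r z|%N)
         / cluster S z
       else cluster S i;
     coefficient := coefficient S;
     exchange := fun r y =>
       if (r == inl z) || (y == z) then - b r y
       else b r y
            + ((`|b r z| * b (inl z) y + b r z * `|b (inl z) y|) %/ 2)%Z |}.

Definition cluster_variables S : set F :=
  [set f | exists (zs : seq I) (i : I), f = cluster (foldl mutate S zs) i]%classic.

Definition finite_type S : Prop := finite_set (cluster_variables S).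

End Mutation.

Definition ksubset (k n : nat) := {K : {set 'I_n} | #|K| == k}.

HB.instance Definition _ k n := Finite.on (ksubset k n).

Section CoordinateRing.
Variables (C : numFieldType) (k n : nat).

(* [enum_val] lists the elements of K in increasing order. *)
Definition kminor (R : comNzRingType) (A : 'M[R]_(k, n)) (K : ksubset k n) : R :=
  \det (colsub (fun a : 'I_k => enum_val (cast_ord (esym (eqP (valP K))) a)) A).

(* Elements of the k-th exterior power of C^n are given by their coordinates in
   the basis of the e_K; those of v_1 /\ ... /\ v_k are the maximal minors of
   the matrix with rows v_1, ..., v_k. *)
Definition decomposable (w : {ffun ksubset k n -> C}) : Prop :=
  exists A : 'M[C]_(k, n), w = [ffun K => kminor A K].

Notation coords := {mpoly C[#|{: ksubset k n}|]}.

Definition plucker_ideal : {pred coords} := fun p =>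
  `[< forall w, decomposable w -> p.@[fun i => w (enum_val i)] = 0 >].

Lemma plucker_idealP (p : coords) :
  reflect (forall A : 'M[C]_(k, n), p.@[fun i => kminor A (enum_val i)] = 0)
          (p \in plucker_ideal).
Proof.
have E (A : 'M[C]_(k, n)) : p.@[fun i => [ffun K => kminor A K] (enum_val i)]
    = p.@[fun i => kminor A (enum_val i)].
  by apply: meval_eq => i; rewrite ffunE.
apply: (iffP idP) => [/asboolP h A|h].
  by rewrite -E; apply: h; exists A.
by apply/asboolP => _ [A ->]; rewrite E.
Qed.

Lemma plucker_ideal_closed : idealr_closed plucker_ideal.
Proof.
split.
- by apply/plucker_idealP => A; rewrite meval0.
- apply/negP => /plucker_idealP /(_ 0); rewrite meval1 => /eqP.
  by rewrite oner_eq0.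
- move=> a p q /plucker_idealP hp /plucker_idealP hq.
  by apply/plucker_idealP => A; rewrite mevalD mevalM hp hq mulr0 addr0.
Qed.

HB.instance Definition _ := isIdealr.Build coords plucker_ideal plucker_ideal_closed.

Lemma kminor_map (R S : comNzRingType) (f : {rmorphism R -> S})
    (A : 'M[R]_(k, n)) K : kminor (map_mx f A) K = f (kminor A K).
Proof. by rewrite /kminor -det_map_mx; congr (\det _); apply/matrixP => i j; rewrite !mxE. Qed.

Lemma poly_eval0 (P : {poly C}) : (forall t, P.[t] = 0) -> P = 0.
Proof.
move=> P0; apply: contraTeq isT => nzP.
have /(max_poly_roots nzP) : all (root P) [seq i%:R | i <- iota 0 (size P)].
  by apply/allP => x _; rewrite /root P0.
rewrite map_inj_uniq ?iota_uniq => [/(_ isT)|]; last exact: mulrIn (oner_neq0 _).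
by rewrite size_map size_iota ltnn.
Qed.

Lemma plucker_ideal_prime : prime_idealr_closed plucker_ideal.
Proof.
move=> p q /plucker_idealP pq; apply: contraT; rewrite negb_or => /andP[].
case/plucker_idealP/existsNP => A /eqP pA; case/plucker_idealP/existsNP => B /eqP qB.
pose M : 'M[{poly C}]_(k, n) := \matrix_(i, j) ((A i j)%:P + 'X * (B i j - A i j)%:P).
pose ev (u : coords) := mmap polyC (fun i => kminor M (enum_val i)) u.
have evE u t :
    (ev u).[t] = u.@[fun i => kminor (A + t *: (B - A)) (enum_val i)].
  rewrite /ev /meval /mmap -[LHS]/(horner_eval t _) rmorph_sum.
  apply: eq_bigr => m _; rewrite rmorphM /=; congr (_ * _); first by rewrite /horner_eval hornerC.
  rewrite /mmap1 rmorph_prod; apply: eq_bigr => i _.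
  rewrite rmorphXn -kminor_map; congr (kminor _ _ ^+ _).
  apply/matrixP => a b; rewrite !mxE.
  by rewrite -[LHS]/(_.[t]) hornerD hornerM hornerX !hornerC.
have : ev p * ev q = 0.
  by apply: poly_eval0 => t; rewrite hornerM !evE -mevalM pq.
move/eqP; rewrite mulf_eq0 => /orP[]/eqP ev0.
- by move: pA (evE p 0); rewrite ev0 horner0 scale0r addr0 => /eqP pA /esym.
- by move: qB (evE q 1); rewrite ev0 horner0 scale1r addrC subrK => /eqP qB /esym.
Qed.

HB.instance Definition _ := isPrimeIdealrClosed.Build coords plucker_ideal plucker_ideal_prime.

(* The coordinate ring of X(k,n): polynomial functions on the exterior power
   modulo those vanishing on all decomposable forms. *)
Definition coordinate_ring := {ideal_quot plucker_ideal}.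

HB.instance Definition _ := GRing.ComNzRing.on coordinate_ring.

Definition cr_unit : {pred coordinate_ring} := fun x => `[< exists y, y * x = 1 >].
Definition cr_inv (x : coordinate_ring) : coordinate_ring :=
  if pselect (exists y, y * x = 1) is left e then sval (cid e) else x.

Lemma cr_mulVx : {in cr_unit, left_inverse 1 cr_inv *%R}.
Proof.
move=> x /asboolP ux; rewrite /cr_inv; case: pselect => // e.
exact: svalP (cid e).
Qed.

Lemma cr_unitPl (x y : coordinate_ring) : y * x = 1 -> cr_unit x.
Proof. by move=> yx; apply/asboolP; exists y. Qed.

Lemma cr_invr_out : {in [predC cr_unit], cr_inv =1 id}.
Proof.
move=> x /asboolPn ux; rewrite /cr_inv; by case: pselect.
Qed.

HB.instance Definition _ :=
  GRing.ComNzRing_hasMulInverse.Build coordinate_ring cr_mulVx cr_unitPl cr_invr_out.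

HB.instance Definition _ := GRing.ComUnitRing_isIntegral.Build coordinate_ring
  (@Quotient.rquot_IdomainAxiom _ plucker_ideal).

(* The Plücker coordinate Delta^K in the fraction field; junk value 0 when K
   does not have k elements. *)
Definition plucker (K : {set 'I_n}) : {fraction coordinate_ring} :=
  if insub K is Some K' then
    FracField.tofrac
      (\pi_coordinate_ring%qT 'X_(enum_rank (K' : ksubset k n)) : coordinate_ring)
  else 0.

End CoordinateRing.

(* [m : 'I_n] stands for the element m + 1 of {1, ..., n}, so that the residue
   0 mod n is represented by the largest element n. *)
Definition cyclic_interval (n : nat) (a : int) (l : nat) : {set 'I_n} :=
  [set m : 'I_n | [exists t : 'I_l, ((m.+1)%:Z == a + t%:Z %[mod n%:Z])%Z]].

(* [%/] on int rounds down for a positive divisor, hence is the floor. *)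
Definition p_start (k n i j : nat) : int :=
  n%:Z - k%:Z - ((i%:Z + j%:Z - 2) %/ 2)%Z.

Definition p'_start (k n i j : nat) : int :=
  n%:Z - k%:Z + 2 + ((i%:Z + j%:Z - 1) %/ 2)%Z.

Definition Iset (k n i j : nat) : {set 'I_n} :=
  cyclic_interval n (p_start k n i j) i
  :|: cyclic_interval n (p'_start k n i j) (k - i).

(* The label (a, b) stands for the pair (i, j) = (a + 1, b + 1), with
   1 <= i <= k - 1 and 1 <= j <= n - k - 1; the label s of a coefficient stands
   for the cyclic interval of length k starting at s + 1. *)
Definition gr_mutable (k n : nat) : finType := ('I_k.-1 * 'I_(n - k).-1)%type.

Definition gr_subset (k n : nat) (r : gr_mutable k n + 'I_n) : {set 'I_n} :=
  match r with
  | inl y => Iset k n y.1.+1 y.2.+1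
  | inr s => cyclic_interval n (s.+1)%:Z k
  end.

(* Rows are compared as subsets: distinct boundary pairs may give the same
   cyclic interval, but the four neighbours of a given (i, j) are distinct. *)
Definition gr_exchange (k n : nat) (r : gr_mutable k n + 'I_n)
    (y : gr_mutable k n) : int :=
  let i := y.1.+1 in let j := y.2.+1 in
  if gr_subset r \in [:: Iset k n i.-1 j; Iset k n i.+1 j] then (-1) ^+ (i + j)
  else if gr_subset r \in [:: Iset k n i j.-1; Iset k n i j.+1]
  then - (-1) ^+ (i + j)
  else 0.

Definition gr_seed (C : numFieldType) (k n : nat) :
    seed {fraction coordinate_ring C k n} (gr_mutable k n) 'I_n :=
  {| cluster := fun y => plucker C k (gr_subset (inl y));
     coefficient := fun s => plucker C k (gr_subset (inr s : gr_mutable k n + 'I_n));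
     exchange := @gr_exchange k n |}.

(* Main.v *)
From HB Require Import structures.
Require Import Defs.
From mathcomp Require Import all_boot all_order all_algebra.
From mathcomp Require Import ring_quotient fraction mpoly.
From mathcomp Require Import boolp classical_sets cardinality reals.
From mathcomp.real_closed Require Import complex.
From mathcomp Require Import zify ring.

(** Only n = 6, 7, 8 with k = 3 give finitely many cluster variables, and the
two directions use the initial seed in different ways.

Infinite cases. Evaluate the coordinate ring at the matrix (m^a). By
Vandermonde all Plücker coordinates have values at least 1 there, and since
exchange relations contain no subtraction every cluster variable has a positive
value ([positive_mutate]). The mutable part of the initial quiver is a grid of
size (k-1) x (n-k-1) ([gr_seed_tabulated]); it contains a 2 x 5 grid when k = 3
and n >= 9, and a 3 x 3 grid when k >= 4 and n >= 2k. A few mutations inside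
such a subgrid lead to a double arrow between two vertices x and y such that
the other vertices of the subgrid that meet x or y all form oriented triangles
with the double arrow ([kronecker]). Mutation at x or y reproduces this shape
with the roles of x and y exchanged, and the exchange relation at x then has
the form x x' = y^2 M + M' where M is a monomial in initial variables outside
the subgrid, hence of value at least 1. So the values along the alternating
mutations are strictly log-convex and eventually increase for ever
([kronecker_growth], [kronecker_infinite]).

Finite cases. The types are D_4, E_6 and E_8, with 16, 42 and 128 cluster
variables. Enumerating the seeds (25080 for E_8) is avoided by a closure
criterion that looks at two exchange relations at a time. Give names to some
elements of the field and list exchange relations b c = P + N between them. A
seed is represented if its variables have pairwise compatible names and each of
its columns is one of the relations. Mutation at z replaces the name b of the
variable at z by the partner c in its relation, and changes the relation of
another direction y only through the relations at z and y; the two span a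
pentagon, and the new relation must again be listed. Hence represented seeds
are closed under mutation as soon as two conditions hold, one on single
relations and one on pairs of them ([represented_mutate]).

It remains to produce the relations. Starting from three-term Plücker relations
and one defining relation for each variable that is not a Plücker coordinate,
all of them follow by the identity that three consecutive exchange relations of
a pentagon imply the other two ([pentagon_step_holds]). Cyclic rotation of the
columns of the matrix acts on everything, so relations are recorded, derived
and checked up to rotation: 390 of them for n = 8. The finite verification is
the boolean [certificate]. *)

Set Implicit Arguments.
Unset Strict Implicit.
Unset Printing Implicit Defensive.

Import Order.TTheory GRing.Theory Num.Theory.

(** * Subsets of the initial seed *)

Lemma mem_cyclic_interval n (a c : int) l (m : 'I_n) D :
  (m.+1%:Z - a = D%:Z + c * n%:Z)%R -> l <= n ->
  (m \in cyclic_interval n a l) = (D %% n < l).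
Proof.
move=> mD ln; rewrite inE.
have n0 : 0 < n by case: m {mD} => m; case: n {ln} => //.
have cong (t : nat) : ((m.+1)%:Z == a + t%:Z %[mod n%:Z])%Z = (D == t %[mod n]).
  rewrite (_ : m.+1%:Z = a + (c * n%:Z + D%:Z))%R; last by lia.
  by rewrite eqz_modDl modzMDl !modz_nat.
apply/existsP/idP => [[t]|Dl].
  by rewrite cong => /eqP ->; rewrite modn_small // (leq_trans _ ln).
by exists (Ordinal Dl); rewrite cong /= modn_mod.
Qed.

(** [Iset k n i j] is a pair of arcs of the cycle Z/n: an arc of length i, a gap
of length j and an arc of length k - i. [in_window k i j d] is membership of the
point at distance d after the start of the first arc. *)
Definition in_window k i j d := (d < i) || (i + j <= d < k + j).

(** A rotation by e that matches the two pairs of arcs must send starts of arcs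
to starts of arcs, so either it fixes both arcs or it exchanges them. The proof
looks at the first and last points of the two arcs and of the two gaps. *)
Lemma window_rigid k n i j i' j' e :
  0 < i -> i < k -> 0 < j -> k + j < n -> i' <= k -> k + j' <= n -> e < n ->
  (forall d, d < n -> in_window k i j d =
     in_window k i' j' (if d + e < n then d + e else d + e - n)) ->
  i = i' /\ j = j' \/ e = i' + j' /\ i = k - i' /\ k + j = n - j'.
Proof.
move=> i0 ik j0 jn i'k j'n en W.
have T d : d < n -> in_window k i j d -> 
    in_window k i' j' (if d + e < n then d + e else d + e - n).
  by move=> dn; rewrite (W _ dn).
have F d : d < n -> ~~ in_window k i j d -> 
    ~~ in_window k i' j' (if d + e < n then d + e else d + e - n).
  by move=> dn; rewrite (W _ dn).
have t0 := T 0 ltac:(lia) ltac:(rewrite /in_window; lia).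
have f0 := F n.-1 ltac:(lia) ltac:(rewrite /in_window; lia).
have t1 := T i.-1 ltac:(lia) ltac:(rewrite /in_window; lia).
have f1 := F i ltac:(lia) ltac:(rewrite /in_window; lia).
have t2 := T (i + j) ltac:(lia) ltac:(rewrite /in_window; lia).
have f2 := F (i + j).-1 ltac:(lia) ltac:(rewrite /in_window; lia).
have t3 := T (k + j).-1 ltac:(lia) ltac:(rewrite /in_window; lia).
have f3 := F (k + j) ltac:(lia) ltac:(rewrite /in_window; lia).
clear T F W.
have [e0|e1] : e = 0 \/ e = i' + j'.
- clear t1 t2 t3 f1 f2 f3; move: t0 f0; rewrite /in_window.
  by case: ifP => ? ?; case: ifP => ?; lia.
- left; subst e; move: t1 t2 t3 f1 f2 f3 t0; rewrite !addn0 /in_window.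
  do ?(rewrite ifT; last by lia).
  by lia.
- right; clear t0 f0 t3 f3; have [lt|ge] := ltnP (i.-1 + e) n; last first.
    exfalso; clear t2 f2; move: t1 f1; rewrite /in_window.
    rewrite ifF; last by lia.
    by rewrite ifF; last lia; lia.
  have ei : i = k - i'.
    clear t2 f2; move: t1 f1; rewrite lt /in_window.
    by case: ifP => ?; lia.
  split=> //; split=> //; move: t2 f2; clear t1 f1; rewrite /in_window.
  have [lt2|ge2] := ltnP (i + j + e) n; first by lia.
  by case: ifP => ?; lia.
Qed.

Section Grid.
Variables k n : nat.

(** The first arc of [Iset k n i j] starts at n - k + 1 - (i + j)/2, in the
numbering from 1; m stands for m + 1. *)
Definition offset i j m := (m + k + (i + j)./2) %% n.

Lemma mem_Iset i j (m : 'I_n) : i <= k -> k + j <= n ->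
  (m \in Iset k n i j) = in_window k i j (offset i j m).
Proof.
move=> ik jn; rewrite /Iset finset.in_setU.
have n0 : 0 < n by case: m => m; case: n jn => //.
rewrite (@mem_cyclic_interval _ _ (-1) _ _ (m + k + (i + j)./2)); last 2 first.
- rewrite /p_start; lia.
- lia.
rewrite (@mem_cyclic_interval _ _ (-2) _ _ (m + k + (i + j)./2 + (n - (i + j)))); last 2 first.
- rewrite /p'_start; lia.
- lia.
rewrite /in_window /offset -(modnDml (m + k + (i + j)./2)).
set d := _ %% n; have dn : d < n by rewrite ltn_mod.
congr (_ || _); have [sd|ds] := leqP (i + j) d.
- rewrite (_ : d + (n - (i + j)) = (d - (i + j)) + n); last by lia.
  by rewrite modnDr modn_small; lia.
- by rewrite modn_small; lia.
Qed.

Lemma card_window (P : pred nat) h : #|[set m : 'I_n | P ((m + h) %% n)]| = count P (iota 0 n).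
Proof.
case: n => [|n']; first by rewrite eq_card0 // => -[].
pose f (m : 'I_n'.+1) : 'I_n'.+1 := inord ((m + h) %% n'.+1).
have fE m : f m = (m + h) %% n'.+1 :> nat by rewrite inordK // ltn_mod.
have f_inj : injective f.
  move=> x y /(congr1 val); rewrite /= !fE => /eqP; rewrite eqn_modDr !modn_small // => /eqP.
  exact: val_inj.
have -> : [set m : 'I_n'.+1 | P ((m + h) %% n'.+1)] = f @^-1: [set x : 'I_n'.+1 | P x].
  by apply/setP => m; rewrite !inE fE.
rewrite card_preimset // cardsE cardE size_filter -val_enum_ord count_map.
by rewrite enumT; apply: eq_count => x.
Qed.

Lemma card_Iset i j : i <= k -> k + j <= n -> #|Iset k n i j| = k.
Proof.
move=> ik jn.
have -> : Iset k n i j = [set m : 'I_n | in_window k i j ((m + (k + (i + j)./2)) %% n)].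
  by apply/setP => m; rewrite mem_Iset // inE /offset addnA.
rewrite card_window (_ : n = i + (j + ((k - i) + (n - (k + j))))); last by lia.
rewrite !iotaD !count_cat.
have cT (P : pred nat) a l : (forall x, a <= x < a + l -> P x) -> count P (iota a l) = l.
  move=> Pa; rewrite -[RHS](size_iota a l); apply/eqP; rewrite -all_count.
  by apply/allP => x; rewrite mem_iota => /Pa.
have cF (P : pred nat) a l : (forall x, a <= x < a + l -> ~~ P x) -> count P (iota a l) = 0.
  move=> Pa; apply/eqP; rewrite -leqn0 leqNgt -has_count; apply/hasPn => x.
  by rewrite mem_iota => /Pa.
rewrite (cT _ 0) ?(cF _ (0 + i)) ?(cT _ (0 + i + j)) ?cF; try by rewrite /in_window => x; lia.
by lia.
Qed.

Lemma card_cyclic_interval (s : 'I_n) : k <= n -> #|cyclic_interval n (s.+1)%:Z k| = k.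
Proof.
move=> kn.
have -> : cyclic_interval n (s.+1)%:Z k = [set m : 'I_n | (m + (n - s)) %% n < k].
  apply/setP => m; rewrite [RHS]inE (@mem_cyclic_interval _ _ (-1) _ _ (m + (n - s))) //.
  have := ltn_ord s; lia.
rewrite (card_window (fun d => d < k)) {1}(_ : n = k + (n - k)); last by lia.
rewrite iotaD count_cat -[RHS]addn0; congr (_ + _).
  rewrite -[RHS](size_iota 0 k); apply/eqP; rewrite -all_count.
  by apply/allP => x; rewrite mem_iota.
apply/eqP; rewrite -leqn0 leqNgt -has_count; apply/hasPn => x.
by rewrite mem_iota; lia.
Qed.

(** Two pairs of arcs with the same position are equal only if their lengths
agree. If instead the arcs were exchanged, then i' = k - i and j' = n - k - j,
and the starting points prescribed for the two sets would differ by about n/2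
from the rotation needed; this is [dl0]. *)
Lemma Iset_inj i j i' j' : 0 < i < k -> 0 < j -> k + j < n -> i' <= k -> k + j' <= n ->
  Iset k n i j = Iset k n i' j' -> i = i' /\ j = j'.
Proof.
move=> /andP[i0 ik] j0 jn i'k j'n E.
pose dl := (i' + j')./2 + n - (i + j)./2.
have sn : (i + j)./2 <= n by lia.
have W d : d < n -> in_window k i j d = in_window k i' j' ((d + dl) %% n).
  move=> dn; have n0 : 0 < n by lia.
  pose m := (d + (2 * n - k - (i + j)./2)) %% n.
  have mn : m < n by rewrite ltn_mod.
  have := congr1 (fun A : {set 'I_n} => Ordinal mn \in A) E.
  have -> : (Ordinal mn \in Iset k n i j) = in_window k i j d.
    rewrite mem_Iset //=; [congr (in_window _ _ _ _)|lia..].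
    rewrite /offset /m -!addnA modnDml.
    rewrite (_ : d + (2 * n - k - (i + j)./2) + (k + (i + j)./2) = d + n + n); last by lia.
    by rewrite !modnDr modn_small.
  move=> ->; rewrite mem_Iset //=; congr (in_window _ _ _ _).
  rewrite /offset /m -!addnA modnDml.
  rewrite (_ : d + (2 * n - k - (i + j)./2) + (k + (i' + j')./2) = d + dl + n); last by rewrite /dl; lia.
  by rewrite modnDr.
(* The exchange of the two arcs would need a rotation by n - (i + j). *)
have dl0 : dl %% n = i' + j' -> i = k - i' -> k + j = n - j' -> False.
  move=> E1 E2 E3; have := divn_eq dl n; rewrite E1.
  move: (dl %/ n) => [|[|q]]; rewrite /dl ?mul0n ?mulSn ?mulSn => E4.
  - lia.
  - lia.
  - by move: (q * n) E4 => z E4; clear -E4 jn; lia.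
pose e := dl %% n; have en : e < n by rewrite ltn_mod; lia.
have W2 d : d < n -> in_window k i j d = in_window k i' j' (if d + e < n then d + e else d + e - n).
  move=> dn; rewrite W // -modnDmr -/e; case: ifP => [lt|/negbT ge]; first by rewrite modn_small.
  have ne : n <= d + e by lia.
  by rewrite -[in LHS](subnK ne) modnDr modn_small //; lia.
have [//|[E1 [E2 E3]]] := window_rigid i0 ik j0 jn i'k j'n en W2.
by case: (dl0 E1 E2 E3).
Qed.

End Grid.

(** * Values of fractions at a matrix *)

Local Open Scope ring_scope.

Section Values.
Variables (R : idomainType) (C : fieldType) (e : {rmorphism R -> C}).
Implicit Types (f g : {fraction R}).

(** The ring morphism e extends to fractions whose denominator it does not kill.
A relation avoids the choice of a representative, which may be a bad one. *)
Definition has_value f (v : C) : Prop :=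
  exists p q : R, [/\ e q != 0, f = tofrac p / tofrac q & e p = v * e q].

Lemma tofrac_neq0 (q : R) : e q != 0 -> tofrac q != 0.
Proof. by rewrite tofrac_eq0; apply: contraNneq => ->; rewrite rmorph0. Qed.

Lemma has_value_fun f v w : has_value f v -> has_value f w -> v = w.
Proof.
move=> [p [q [q0 -> ev]]] [p' [q' [q'0 /eqP E ev']]].
move: E; rewrite eqr_div ?tofrac_neq0 //.
rewrite -!rmorphM /= tofrac_eq => /eqP /(congr1 e).
rewrite !rmorphM ev ev' => E.
by apply: (mulIf q0); apply: (mulIf q'0); rewrite E mulrAC.
Qed.

Lemma has_value_ring (p : R) : has_value (tofrac p) (e p).
Proof. by exists p, 1; rewrite !rmorph1 oner_neq0 mulr1 divr1; split. Qed.

Lemma has_value1 : has_value 1 1.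
Proof. by rewrite -(rmorph1 e) -(rmorph1 (@tofrac R)); apply: has_value_ring. Qed.

Lemma has_valueD f g v w :
  has_value f v -> has_value g w -> has_value (f + g) (v + w).
Proof.
move=> [p [q [q0 -> ev]]] [p' [q' [q'0 -> ev']]].
exists (p * q' + p' * q), (q * q'); split.
- by rewrite rmorphM mulf_neq0.
- by rewrite addf_div ?tofrac_neq0 // rmorphD !rmorphM.
- by rewrite rmorphD !rmorphM ev ev' /=; ring.
Qed.

Lemma has_valueM f g v w :
  has_value f v -> has_value g w -> has_value (f * g) (v * w).
Proof.
move=> [p [q [q0 -> ev]]] [p' [q' [q'0 -> ev']]].
exists (p * p'), (q * q'); split.
- by rewrite rmorphM mulf_neq0.
- by rewrite mulf_div !rmorphM.
- by rewrite !rmorphM ev ev' /=; ring.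
Qed.

Lemma has_valueV f v : v != 0 -> has_value f v -> has_value f^-1 v^-1.
Proof.
move=> v0 [p [q [q0 -> ev]]]; exists q, p; split.
- by rewrite ev mulf_neq0.
- by rewrite invf_div.
- by rewrite ev mulKf.
Qed.

Lemma has_valueX f v m : has_value f v -> has_value (f ^+ m) (v ^+ m).
Proof.
move=> fv; elim: m => [|m IH]; first exact: has_value1.
by rewrite !exprS; apply: has_valueM.
Qed.

Lemma has_value_prod (I : finType) (P : pred I) (F : I -> {fraction R}) (G : I -> C) :
  (forall i, P i -> has_value (F i) (G i)) ->
  has_value (\prod_(i | P i) F i) (\prod_(i | P i) G i).
Proof.
move=> FG; apply: (big_ind2 has_value) => //; first exact: has_value1.
by move=> *; apply: has_valueM.
Qed.

End Values.

Section Evaluation.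
Variables (C : numFieldType) (k n : nat).
Local Notation CR := (coordinate_ring C k n).
Implicit Types (A : 'M[C]_(k, n)).

(** Evaluation of polynomial functions on the cone at the decomposable form whose
coordinates are the maximal minors of A. *)
Definition eval_at A (x : CR) : C :=
  (repr x).@[fun i => kminor A (enum_val i)].

Lemma eval_at_pi A (p : {mpoly C[#|{: ksubset k n}|]}) :
  eval_at A (\pi_(coordinate_ring C k n)%qT p) =
  p.@[fun i => kminor A (enum_val i)].
Proof.
apply/eqP; rewrite -subr_eq0 -mevalB; apply/eqP.
by apply/plucker_idealP; rewrite Quotient.idealrBE reprK.
Qed.

Lemma eval_at_is_zmod_morphism A : zmod_morphism (eval_at A).
Proof.
move=> x y; rewrite -[x in LHS]reprK -[y in LHS]reprK -(rmorphB (\pi_CR%qT)).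
by rewrite eval_at_pi mevalB.
Qed.

Lemma eval_at_is_monoid_morphism A : monoid_morphism (eval_at A).
Proof.
split; first by rewrite -[1](rmorph1 (\pi_CR%qT)) eval_at_pi meval1.
move=> x y; rewrite -[x in LHS]reprK -[y in LHS]reprK -(rmorphM (\pi_CR%qT)).
by rewrite eval_at_pi mevalM.
Qed.

HB.instance Definition _ A :=
  GRing.isZmodMorphism.Build CR C (eval_at A) (eval_at_is_zmod_morphism A).
HB.instance Definition _ A :=
  GRing.isMonoidMorphism.Build CR C (eval_at A) (eval_at_is_monoid_morphism A).

(** The ideal of the cone is by definition the ideal of polynomials that vanish at
all matrices, so identities in the coordinate ring are identities of minors. *)
Lemma coordinate_ring_eq0 (x : CR) : (forall A, eval_at A x = 0) -> x = 0.
Proof.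
move=> x0; rewrite -[x]reprK -[RHS](rmorph0 (\pi_CR%qT)).
by apply/eqP; rewrite -Quotient.idealrBE subr0; apply/plucker_idealP; exact: x0.
Qed.

Lemma has_value_plucker A (K : {set 'I_n}) (cK : #|K| == k) :
  has_value (eval_at A) (plucker C k K) (kminor A (Sub K cK : ksubset k n)).
Proof.
rewrite /plucker insubT.
have <- : eval_at A (\pi_CR%qT 'X_(enum_rank (Sub K cK : ksubset k n))) =
    kminor A (Sub K cK : ksubset k n).
  by rewrite eval_at_pi mevalXU enum_rankK.
exact: has_value_ring.
Qed.

End Evaluation.

(** * Positivity and double arrows *)

Section Positive.
Variables (R : idomainType) (C : numFieldType) (e : {rmorphism R -> C}).
Implicit Types (f g : {fraction R}).

Definition positive_at f := exists2 v : C, 0 < v & has_value e f v.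

Lemma positive_at_neq0 f : positive_at f -> f != 0.
Proof.
move=> [v v0 fv]; apply: contraTneq v0 => f0.
suff -> : v = 0 by rewrite ltxx.
by apply: has_value_fun fv _; rewrite f0 -(rmorph0 (@tofrac R)) -(rmorph0 e); apply: has_value_ring.
Qed.

Lemma positive_atD f g : positive_at f -> positive_at g -> positive_at (f + g).
Proof. by move=> [v v0 fv] [w w0 gw]; exists (v + w); [exact: addr_gt0|exact: has_valueD]. Qed.

Lemma positive_atV f : positive_at f -> positive_at f^-1.
Proof. by move=> [v v0 fv]; exists v^-1; [rewrite invr_gt0|apply: has_valueV => //; rewrite gt_eqF]. Qed.

Lemma positive_atM f g : positive_at f -> positive_at g -> positive_at (f * g).
Proof. by move=> [v v0 fv] [w w0 gw]; exists (v * w); [exact: mulr_gt0|exact: has_valueM]. Qed.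

Lemma positive_atX f m : positive_at f -> positive_at (f ^+ m).
Proof. by move=> [v v0 fv]; exists (v ^+ m); [exact: exprn_gt0|exact: has_valueX]. Qed.

Lemma positive_at_prod (T : finType) (P : pred T) (F : T -> {fraction R}) :
  (forall i, positive_at (F i)) -> positive_at (\prod_(i | P i) F i).
Proof.
move=> F0; apply: big_ind => [|f g|i _] //; last exact: positive_atM.
by exists 1; [exact: ltr01|exact: has_value1].
Qed.

Definition value f : C :=
  if pselect (exists v, has_value e f v) is left h then sval (cid h) else 0.

Lemma valueE f v : has_value e f v -> value f = v.
Proof.
move=> fv; rewrite /value; case: pselect => [h|[]]; last by exists v.
exact: has_value_fun (svalP (cid h)) fv.
Qed.

Lemma value_gt0 f : positive_at f -> 0 < value f.
Proof. by move=> [v v0 /valueE ->]. Qed.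

Lemma has_value_value f : positive_at f -> has_value e f (value f).
Proof. by move=> [v v0 fv]; rewrite (valueE fv). Qed.

Variables I J : finType.
Implicit Types S : seed {fraction R} I J.

Definition positive_seed S := forall r, positive_at (extended_cluster S r).

(** Exchange relations are subtraction-free. *)
Lemma positive_mutate S z : positive_seed S -> positive_seed (mutate S z).
Proof.
move=> S0 [i|j]; last exact: (S0 (inr j)).
rewrite /=; case: eqP => _; last exact: (S0 (inl i)).
apply: positive_atM; last exact: positive_atV (S0 (inl z)).
by apply: positive_atD; apply: positive_at_prod => r; apply: positive_atX.
Qed.

Lemma positive_foldl S zs : positive_seed S -> positive_seed (foldl (@mutate _ I J) S zs).
Proof. by elim: zs S => //= z zs IH S S0; apply/IH/positive_mutate. Qed.

(* [inner] selects the vertices at which mutations are performed. *)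
Variable inner : pred I.

Definition outer (r : I + J) := if r is inl i then ~~ inner i else true.

Definition outer_ge1 S := forall r, outer r -> 1 <= value (extended_cluster S r).

(** A double arrow between x and y such that every other inner vertex that meets
x or y forms an oriented triangle with it. In the exchange relation at x, the
monomial that contains y then contains no other inner vertex, and symmetrically at y. *)
Definition kronecker S x y :=
  [/\ x != y, exchange S (inl x) x = 0, exchange S (inl y) y = 0,
     exchange S (inl x) y = 2 & exchange S (inl y) x = -2] /\
  forall i, inner i -> i != x -> i != y ->
    (exchange S (inl i) x, exchange S (inl i) y) \in [:: (0, 0); (1, -1)].

(** Mutation at x changes the sign of its row and column, and turns the entry -1
between y and the third vertex of a triangle into -1 + 2 = 1. So the triangles
remain, with x and y exchanged. *)
Lemma kronecker_left S x y : kronecker S x y -> kronecker (mutate S x) y x.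
Proof.
move=> [[xy bxx byy bxy byx] out].
have yxF : (y == x) = false by rewrite eq_sym (negPf xy).
have inlE (i j : I) : (inl i == inl j :> I + J) = (i == j) by [].
split; first split; rewrite /= ?inlE ?eqxx ?yxF ?orbT /= ?bxx ?byx ?bxy ?byy //.
move=> i ii iy ix; have := out i ii ix iy.
rewrite inlE (negPf ix) ?yxF /= !inE !xpair_eqE.
by case/orP => /andP[/eqP -> /eqP ->].
Qed.

Lemma kronecker_right S x y : kronecker S x y -> kronecker (mutate S y) y x.
Proof.
move=> [[xy bxx byy bxy byx] out].
have yxF : (y == x) = false by rewrite eq_sym (negPf xy).
have inlE (i j : I) : (inl i == inl j :> I + J) = (i == j) by [].
split; first split; rewrite /= ?inlE ?eqxx ?yxF ?(negPf xy) ?orbT /= ?bxx ?byx ?bxy ?byy //.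
move=> i ii iy ix; have := out i ii ix iy.
rewrite inlE (negPf iy) ?(negPf xy) /= !inE !xpair_eqE.
by case/orP => /andP[/eqP -> /eqP ->].
Qed.

Lemma value_monomial S (P : pred (I + J)) (b : I + J -> int) q :
  positive_seed S -> outer_ge1 S -> P (inl q) -> b (inl q) = 2 \/ b (inl q) = -2 ->
  (forall r, P r -> r != inl q -> outer r) ->
  value (cluster S q) ^+ 2 <=
  value (\prod_(r | P r) extended_cluster S r ^+ `|b r|%N).
Proof.
move=> S0 S1 Pq bq out.
have -> : value (\prod_(r | P r) extended_cluster S r ^+ `|b r|%N) =
   \prod_(r | P r) value (extended_cluster S r) ^+ `|b r|%N.
  by apply: valueE; apply: has_value_prod => r _; apply: has_valueX; apply: has_value_value.
rewrite (bigD1 (inl q)) //=.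
have -> : `|b (inl q)|%N = 2 by case: bq => ->.
rewrite -[leLHS]mulr1; apply: ler_wpM2l.
  by apply/exprn_ge0/ltW/value_gt0/(S0 (inl q)).
elim/big_ind : _ => // [x y x1 y1|r /andP[Pr rq]].
  by rewrite -[1]mulr1 ler_pM.
by apply: exprn_ege1; apply: S1; apply: out.
Qed.

(** One of the two monomials of the exchange relation at p is the square of the
variable at q times outer variables, whose values are at least 1; the other one
makes the inequality strict. *)
Lemma kronecker_growth S p q :
  positive_seed S -> outer_ge1 S -> kronecker S p q \/ kronecker S q p ->
  value (cluster S q) ^+ 2 < value (cluster (mutate S p) p) * value (cluster S p).
Proof.
move=> S0 S1 K.
set P1 := \prod_(r | 0 < exchange S r p) extended_cluster S r ^+ `|exchange S r p|%N.
set P2 := \prod_(r | exchange S r p < 0) extended_cluster S r ^+ `|exchange S r p|%N.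
have pos1 : positive_at P1 by apply: positive_at_prod => r; apply: positive_atX.
have pos2 : positive_at P2 by apply: positive_at_prod => r; apply: positive_atX.
have -> : value (cluster (mutate S p) p) * value (cluster S p) = value P1 + value P2.
  have Sp := S0 (inl p); have vp := value_gt0 Sp.
  suff -> : value (cluster (mutate S p) p) = (value P1 + value P2) / value (cluster S p).
    by rewrite mulfVK // gt_eqF.
  rewrite /= eqxx; apply: valueE; apply: has_valueM.
    by apply: has_valueD; apply: has_value_value.
  by apply: has_valueV; [rewrite gt_eqF|exact: (has_value_value Sp)].
suff [Q|Q] : value (cluster S q) ^+ 2 <= value P1 \/ value (cluster S q) ^+ 2 <= value P2.
- by apply: le_lt_trans Q _; rewrite ltrDl value_gt0.
- by apply: le_lt_trans Q _; rewrite ltrDr value_gt0.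
case: K => -[[xy bxx byy bxy byx] out]; [right|left];
  (apply: value_monomial => //; first by rewrite ?bxy ?byx); try by rewrite ?bxy ?byx; auto.
- move=> [i|//] /= bi /eqP iq; apply/negP => ii; move: bi.
  have [->|ip] := eqVneq i p; first by rewrite bxx.
  have /(out i ii ip) : i != q by apply/eqP => E; apply: iq; rewrite E.
  by rewrite !inE !xpair_eqE => /orP[] /andP[/eqP -> _].
- move=> [i|//] /= bi /eqP iq; apply/negP => ii; move: bi.
  have [->|ip] := eqVneq i p; first by rewrite byy.
  have iq' : i != q by apply/eqP => E; apply: iq; rewrite E.
  have := out i ii iq' ip.
  by rewrite !inE !xpair_eqE => /orP[] /andP[_ /eqP ->].
Qed.

Lemma outer_ge1_mutate S z : inner z -> outer_ge1 S -> outer_ge1 (mutate S z).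
Proof.
move=> iz S1 [i|j] // oi; last exact: (S1 (inr j)).
rewrite /=; case: eqP => [E|_]; last exact: (S1 (inl i)).
by move: oi; rewrite /= E iz.
Qed.

(** Let u_m be the values of the variables that arise by alternating mutations. By
[kronecker_growth], u_(m+1) u_(m-1) > u_m^2, so the ratios u_(m+1) / u_m increase
strictly. Going forwards or backwards according to which of x and y has the larger
value, all ratios after the first exceed 1 and the values are distinct. *)
Lemma kronecker_infinite S x y :
  positive_seed S -> outer_ge1 S -> inner x -> inner y -> kronecker S x y -> ~ finite_type S.
Proof.
move=> S0 S1 ix iy K.
pose st := (seed {fraction R} I J * I * I)%type.
(* In a state (T, p, q) the next mutation is at p; q has the latest variable. *)
pose good (T : st) :=
  [/\ positive_seed T.1.1, outer_ge1 T.1.1, inner T.1.2, inner T.2 &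
   (kronecker T.1.1 T.1.2 T.2 \/ kronecker T.1.1 T.2 T.1.2) /\
   value (cluster T.1.1 T.1.2) <= value (cluster T.1.1 T.2)].
pose next (T : st) : st := (mutate T.1.1 T.1.2, T.2, T.1.2).
pose latest (T : st) := cluster T.1.1 T.2.
have next_good T : good T -> good (next T) /\ value (latest T) < value (latest (next T)).
  case: T => [[T p] q] [/= T0 T1 ip iq [KK le]].
  have vp := value_gt0 (T0 (inl p)); have vq := value_gt0 (T0 (inl q)).
  have lt : value (cluster T q) < value (cluster (mutate T p) p).
    rewrite -(ltr_pM2r vp); apply: le_lt_trans (kronecker_growth T0 T1 KK).
    by rewrite expr2 ler_wpM2l // ltW.
  split=> //; split=> //; [exact: positive_mutate|exact: outer_ge1_mutate|split].
    by case: KK => KK; [left; apply: kronecker_left|right; apply: kronecker_right].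
  have qp : q == p = false by case: KK => -[[] /negPf pq *]; rewrite // eq_sym.
  by apply: ltW; move: lt; rewrite /= qp.
have [T gT TS] : exists2 T, good T & T.1.1 = S.
  have [le|le] : value (cluster S x) <= value (cluster S y) \/
                 value (cluster S y) <= value (cluster S x).
    by apply/orP/real_leVge; apply: gtr0_real; exact: value_gt0 (S0 (inl _)).
  - by exists (S, x, y) => //; split=> //; split=> //; left.
  - by exists (S, y, x) => //; split=> //; split=> //; right.
have good_iter m : good (iter m next T).
  by elim: m => // m IH; rewrite iterS; case: (next_good _ IH).
have incr m d : value (latest (iter m next T)) < value (latest (iter (d + m).+1 next T)).
  elim: d => [|d IH]; first by case: (next_good _ (good_iter m)).
  by apply: lt_trans IH _; rewrite [iter (d.+1 + m).+1 _ _]iterS; case: (next_good _ (good_iter (d.+1 + m)%N)).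
pose u m := latest (iter m next T).
have u_inj : injective u.
  move=> m m' E; apply/eqP; move: E; wlog lt : m m' / (m < m')%N.
    move=> H E; case: (ltngtP m m') => // lt; first by have /eqP := H _ _ lt E; lia.
    by have /eqP := H _ _ lt (esym E); lia.
  have := incr m (m' - m.+1)%N; rewrite (_ : (m' - m.+1 + m).+1 = m'); last by lia.
  by rewrite /u => + E; rewrite E ltxx.
have u_var m : cluster_variables S (u m).
  suff [zs E] : exists zs, (iter m next T).1.1 = foldl (@mutate _ I J) S zs.
    by exists zs, (iter m next T).2; rewrite -E.
  elim: m => [|m [zs IH]]; first by exists [::].
  by exists (rcons zs (iter m next T).1.2); rewrite foldl_rcons -IH.
move=> fin; apply: infinite_nat.
apply: (@sub_finite_set _ _ (u @^-1` cluster_variables S)); first by move=> m _; exact: u_var.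
by apply: finite_preimage => // a b _ _; apply: u_inj.
Qed.
End Positive.

(** * Evaluation at a Vandermonde matrix *)

(** Minors are taken along the enumeration of a subset, which is increasing. *)
Lemma enum_val_increasing n (A : {set 'I_n}) (i j : 'I_#|A|) :
  (i < j)%N -> (enum_val i < enum_val j)%N.
Proof.
move=> ij; pose lt := relpre (val : 'I_n -> nat) ltn.
have srt : sorted lt (enum A).
  rewrite /enum_mem; apply: sorted_filter; first by move=> y x z; apply: ltn_trans.
  by rewrite -enumT -sorted_map val_enum_ord iota_ltn_sorted.
rewrite (enum_val_nth (enum_val i)) [X in (_ < val X)%N](enum_val_nth (enum_val i)).
by apply: (sorted_ltn_nth _ _ srt); rewrite ?inE -?cardE ?ltn_ord // => y x z; apply: ltn_trans.
Qed.

Section Vandermonde.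
Variables (C : numFieldType) (k n : nat).

(** With integer nodes, all factors x_j - x_i of the minors are at least 1. *)
Definition vandermonde : 'M[C]_(k, n) := \matrix_(a, m) (m%:R ^+ a).

Lemma kminor_vandermonde_ge1 (K : ksubset k n) : 1 <= kminor vandermonde K.
Proof.
rewrite /kminor; set f := fun a : 'I_k => enum_val _.
have -> : colsub f vandermonde = Vandermonde k (\row_a (f a)%:R).
  by apply/matrixP => a b; rewrite !mxE.
rewrite det_Vandermonde.
have ge1 (I : finType) (P : pred I) (F : I -> C) :
    (forall i, P i -> 1 <= F i) -> 1 <= \prod_(i | P i) F i.
  move=> F1; elim/big_ind : _ => // x y x1 y1; by rewrite -[1]mulr1 ler_pM.
apply: (ge1) => i _; apply: (ge1) => j ij; rewrite !mxE -natrB.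
  by rewrite ler1n subn_gt0 enum_val_increasing.
by rewrite ltnW // enum_val_increasing.
Qed.

Variable I J : finType.
Variable S : seed {fraction coordinate_ring C k n} I J.
Variable sub : I + J -> {set 'I_n}.
Hypothesis card_sub : forall r, #|sub r| = k.
Hypothesis S_sub : forall r, extended_cluster S r = plucker C k (sub r).

Lemma has_value_seed r : exists2 v, 1 <= v &
  has_value (eval_at vandermonde) (extended_cluster S r) v.
Proof.
have cK : #|sub r| == k by rewrite card_sub.
exists (kminor vandermonde (Sub (sub r) cK : ksubset k n)); first exact: kminor_vandermonde_ge1.
by rewrite S_sub; apply: has_value_plucker.
Qed.

Lemma positive_plucker_seed : positive_seed (eval_at vandermonde) S.
Proof.
by move=> r; have [v v1 Sv] := has_value_seed r; exists v => //; apply: lt_le_trans v1.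
Qed.

Lemma plucker_seed_ge1 r : 1 <= value (eval_at vandermonde) (extended_cluster S r).
Proof. by have [v v1 /valueE ->] := has_value_seed r. Qed.

End Vandermonde.

(** * Grids of size 3 x 3 and 2 x 5 have infinitely many cluster variables *)

Section Tables.
Variable N : nat.

(** The part of an exchange matrix with rows and columns in a subgrid is determined
by the same part of the initial matrix as long as mutations stay in the subgrid,
so it can be computed without knowing the rest of the quiver. *)
Definition entry (M : seq (seq int)) p q : int := nth 0 (nth [::] M p) q.

Definition table (f : nat -> nat -> int) := mkseq (fun p => mkseq (f p) N) N.

Lemma entry_table f p q : (p < N)%N -> (q < N)%N -> entry (table f) p q = f p q.
Proof. by move=> pN qN; rewrite /entry !nth_mkseq. Qed.

Definition mutate_table (M : seq (seq int)) (z : nat) := table (fun r y =>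
  let b := entry M in
  if (r == z) || (y == z) then - b r y
  else b r y + ((`|b r z| * b z y + b r z * `|b z y|) %/ 2)%Z).

Definition kronecker_table (M : seq (seq int)) (x y : nat) :=
  [&& x != y, entry M x x == 0, entry M y y == 0, entry M x y == 2, entry M y x == - 2 &
   all (fun i => [|| i == x, i == y |
     (entry M i x, entry M i y) \in [:: (0, 0); (1, -1)]]) (iota 0 N)].

End Tables.

(** Entry p of the table stands for the vertex in row p / w and column p %% w of
the h x w grid; its horizontal and vertical arrows alternate in sign. *)
Definition grid_table h w := table (h * w) (fun r y =>
  let: (a, b) := (r %/ w, r %% w)%N in let: (i, j) := ((y %/ w).+1, (y %% w).+1)%N in
  let s : int := if odd (i + j) then -1 else 1 in
  if (a.+1, b.+1) \in [:: (i.-1, j); (i.+1, j)] then s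
  else if (a.+1, b.+1) \in [:: (i, j.-1); (i, j.+1)] then - s else 0).

Section Subgrid.
Variables (F : fieldType) (k n h w : nat).
Hypotheses (kh : (h < k)%N) (nw : (w < n - k)%N).
Local Notation mutables := (gr_mutable k n).
Implicit Types (S : seed F mutables 'I_n) (y z : mutables).

Definition in_subgrid y := (y.1 < h)%N && (y.2 < w)%N.
Definition position y := (y.1 * w + y.2)%N.

Lemma position_lt y : in_subgrid y -> (position y < h * w)%N.
Proof. rewrite /in_subgrid /position; nia. Qed.

Lemma position_div y : in_subgrid y -> (position y %/ w = y.1)%N.
Proof. by move=> /andP[_ yw]; rewrite divnMDl ?divn_small ?addn0 //; lia. Qed.

Lemma position_mod y : in_subgrid y -> (position y %% w = y.2)%N.
Proof. by move=> /andP[_ yw]; rewrite modnMDl modn_small. Qed.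

Lemma position_inj y z : in_subgrid y -> in_subgrid z ->
  (position y == position z) = (y == z).
Proof.
move=> yg zg; apply/eqP/eqP => [E|-> //].
have := position_div yg; have := position_mod yg; rewrite E position_div // position_mod //.
by case: y z {yg zg E} => [a b] [c d] /= /val_inj -> /val_inj ->.
Qed.

Lemma position_surj p : (p < h * w)%N -> exists2 y, in_subgrid y & position y = p.
Proof.
move=> pN; have w0 : (0 < w)%N by lia.
have a_lt : (p %/ w < h)%N by rewrite ltn_divLR.
have b_lt : (p %% w < w)%N by rewrite ltn_mod.
have ak : (p %/ w < k.-1)%N by lia.
have bn : (p %% w < (n - k).-1)%N by lia.
exists (Ordinal ak, Ordinal bn); first by rewrite /in_subgrid /= a_lt.
by rewrite /position /= -divn_eq.
Qed.

Definition tabulated S M := forall y z, in_subgrid y -> in_subgrid z ->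
  exchange S (inl y) z = entry M (position y) (position z).

Lemma tabulated_mutate S M z : in_subgrid z -> tabulated S M ->
  tabulated (mutate S z) (mutate_table (h * w) M (position z)).
Proof.
move=> zg SM r y rg yg; rewrite entry_table ?position_lt //= !position_inj //.
by rewrite !SM.
Qed.

Lemma tabulated_mutations S M ps : all (fun p => p < h * w)%N ps -> tabulated S M ->
  exists2 zs, all in_subgrid zs &
    tabulated (foldl (@mutate F _ _) S zs) (foldl (mutate_table (h * w)) M ps).
Proof.
elim: ps S M => [|p ps IH] S M /=; first by exists [::].
move=> /andP[pN psN] SM; have [z zg zp] := position_surj pN.
have [|zs zsg H] := IH (mutate S z) (mutate_table (h * w) M p) psN.
  by rewrite -zp; apply: tabulated_mutate.
by exists (z :: zs) => //=; rewrite zg.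
Qed.

End Subgrid.

Section GridSeed.
Variables (C : numFieldType) (k n h w : nat).
Hypotheses (kh : (h < k)%N) (nw : (w < n - k)%N).

Lemma gr_seed_tabulated : tabulated h w (gr_seed C k n) (grid_table h w).
Proof.
move=> y z yg zg; rewrite entry_table ?position_lt //.
rewrite (position_div kh nw yg) (position_div kh nw zg).
rewrite (position_mod yg) (position_mod zg).
case: y z {yg zg} => [a b] [c d] /=.
have [[ak bn] [ck dn]] := ((ltn_ord a, ltn_ord b), (ltn_ord c, ltn_ord d)).
have inj i j : (i <= k)%N -> (k + j <= n)%N ->
    (Iset k n a.+1 b.+1 == Iset k n i j) = ((a.+1, b.+1)%N == (i, j)).
  move=> ik jn; apply/eqP/eqP => [E|[-> ->] //].
  by have [|||||-> ->] := @Iset_inj k n a.+1 b.+1 i j _ _ _ _ _ E => //; lia.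
rewrite /gr_exchange /= !inE !inj; try lia.
by rewrite -signr_odd addSn oddS; case: (odd _).
Qed.

Lemma gr_seed_plucker r :
  extended_cluster (gr_seed C k n) r = plucker C k (gr_subset r).
Proof. by case: r. Qed.

Lemma card_gr_subset (r : gr_mutable k n + 'I_n) : #|gr_subset r| = k.
Proof.
case: r => [[i j]|s] /=; last by rewrite card_cyclic_interval; lia.
by have [ik jn] := (ltn_ord i, ltn_ord j); rewrite card_Iset //; lia.
Qed.

(** The vertices of the seed outside the subgrid keep their initial variables, which
are Plücker coordinates and have values at least 1. *)
Lemma subgrid_infinite ps x y :
  all (fun p => p < h * w)%N [:: x, y & ps] ->
  kronecker_table (h * w) (foldl (mutate_table (h * w)) (grid_table h w) ps) x y ->
  ~ finite_type (gr_seed C k n).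
Proof.
move=> /= /and3P[xN yN psN] K fin.
have [zs zsg tab] := tabulated_mutations kh nw psN gr_seed_tabulated.
have [x' xg xE] := position_surj kh nw xN; have [y' yg yE] := position_surj kh nw yN.
move: K => /and5P[xy /eqP Kxx /eqP Kyy /eqP Kxy /andP[/eqP Kyx /allP out]].
set S := foldl _ _ zs in tab.
pose e := eval_at (vandermonde C k n).
have S0 : positive_seed e (gr_seed C k n).
  exact: positive_plucker_seed card_gr_subset gr_seed_plucker.
have S1 : outer_ge1 e (@in_subgrid k n h w) (gr_seed C k n).
  by move=> r _; apply: (plucker_seed_ge1 card_gr_subset gr_seed_plucker).
apply: (@kronecker_infinite _ _ e _ _ (@in_subgrid k n h w) S x' y') => //.
- exact: positive_foldl.
- rewrite /S; elim: zs (gr_seed C k n) S1 zsg {tab S S0 fin} => //= z zs IH T T1 /andP[zg zsg].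
  by apply: IH => //; apply: outer_ge1_mutate.
- split; first split; rewrite ?tab // ?xE ?yE //.
    by apply: contraNneq xy => E; rewrite -xE -yE E.
  move=> i ig ix iy; rewrite !tab // xE yE.
  have /out : position w i \in iota 0 (h * w) by rewrite mem_iota position_lt.
  by rewrite -xE -yE (position_inj kh nw ig xg) (position_inj kh nw ig yg) (negPf ix) (negPf iy).
- apply: sub_finite_set fin => f [us [i ->]].
  by exists (zs ++ us), i; rewrite foldl_cat.
Qed.

End GridSeed.

(** Mutation at the centre and at three of its neighbours (above, left, right)
gives a double arrow between the remaining neighbour, below, and the one above. *)
Lemma grid33_infinite (C : numFieldType) k n : (3 < k)%N -> (3 < n - k)%N ->
  ~ finite_type (gr_seed C k n).
Proof.
move=> k3 n3; apply: (@subgrid_infinite C k n 3 3 k3 n3 [:: 4; 1; 3; 5] 7 1) => //.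
Qed.

(** The mutations and the double arrow are the outcome of a breadth-first search in
the mutation class of the 2 x 5 grid. *)
Lemma grid25_infinite (C : numFieldType) k n : (2 < k)%N -> (5 < n - k)%N ->
  ~ finite_type (gr_seed C k n).
Proof.
move=> k3 n3; apply: (@subgrid_infinite C k n 2 5 k3 n3 [:: 0; 1; 3; 2; 0; 4; 6; 8] 3 2) => //.
Qed.

(** * Seeds represented by a table of exchange relations *)

(** The exchange relation between two names in V: old * new is the sum of the
monomials [pos] and [neg], given as lists of names with multiplicities. *)
Record exrel (V : Type) := Exrel { old : V; new : V; pos : seq V; neg : seq V }.

Section ExrelEqType.
Variable V : eqType.
Definition exrel_code (r : exrel V) := (old r, new r, pos r, neg r).
Definition exrel_decode (c : V * V * seq V * seq V) :=
  let: (b, c, P, N) := c in Exrel b c P N.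
Lemma exrel_codeK : cancel exrel_code exrel_decode. Proof. by case. Qed.
HB.instance Definition _ := Equality.copy (exrel V) (can_type exrel_codeK).
End ExrelEqType.

Definition flip V (r : exrel V) := Exrel (new r) (old r) (pos r) (neg r).
Definition swap V (r : exrel V) := Exrel (old r) (new r) (neg r) (pos r).

Definition monomial (F : fieldType) V (X : V -> F) (s : seq V) : F := \prod_(v <- s) X v.

Definition holds (F : fieldType) V (X : V -> F) (r : exrel V) :=
  X (old r) * X (new r) = monomial X (pos r) + monomial X (neg r).

Section Closure.
Variables (F : fieldType) (I J : finType) (V : eqType) (X : V -> F).
Variables (E : exrel V -> Prop) (A : rel V) (frozen : pred V) (fz : J -> V).

Definition compatible_list (s : seq V) :=
  forall v w, v \in s -> w \in s -> ~~ frozen v -> ~~ frozen w -> v = w \/ A v w.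

(* E is the set of relations, A the compatibility of names, and fz names the
coefficients, which are the frozen names that occur in seeds. *)
Hypothesis fz_inj : injective fz.
Hypothesis fz_frozen : forall j, frozen (fz j).
Hypothesis A_irr : forall v, ~~ A v v.
Hypothesis E_swap : forall r, E r -> E (swap r).
Hypothesis E_flip : forall r, E r -> E (flip r).
Hypothesis E_holds : forall r, E r -> holds X r.
Hypothesis E_neq0 : forall r, E r -> X (old r) != 0.
Hypothesis E_wf : forall r, E r ->
  [/\ ~~ frozen (old r), old r != new r, old r \notin pos r, {in pos r, forall v, v \notin neg r}
    & {in pos r, forall v, ~~ frozen v -> count_mem v (pos r) = 1%N}].
(* [E_link]: a name that is compatible with all that a seed must contain for the
relation to be one of its columns is compatible with the new name. *)
Hypothesis E_link : forall r w, E r -> A w (old r) ->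
  (forall v, v \in pos r ++ neg r -> ~~ frozen v -> w = v \/ A w v) ->
  A w (new r) /\ A (new r) w.
(* [E_pentagon]: r and r2 are two columns of a common seed joined by one arrow.
After mutation along r the column r2 becomes r4, whose monomials arise from
those of r2 by replacing old r by pos r in one and multiplying the other by new
r, up to common factors. *)
Hypothesis E_pentagon : forall r r2, E r -> E r2 ->
  old r \in pos r2 -> old r2 \in neg r ->
  compatible_list [:: old r, old r2 & pos r ++ neg r ++ pos r2 ++ neg r2] ->
  exists r4, [/\ E r4, old r4 = old r2 &
    perm_eq (neg r4 ++ pos r2 ++ pos r) (old r :: pos r4 ++ new r :: neg r2)].

Definition name_of (b : I -> V) (r : I + J) : V :=
  match r with inl i => b i | inr j => fz j end.

(** The row of a variable x in the column is the exponent of x in the ratio of the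
two monomials. *)
Definition column (S : seed F I J) (b : I -> V) (r : exrel V) (y : I) :=
  forall r', exchange S r' y =
    (count_mem (name_of b r') (pos r))%:Z - (count_mem (name_of b r') (neg r))%:Z.

Record represented (S : seed F I J) (b : I -> V) : Prop := {
  rep_cluster : forall i, cluster S i = X (b i);
  rep_coefficient : forall j, coefficient S j = X (fz j);
  rep_compat : forall i j, i != j -> A (b i) (b j);
  rep_skew : forall i j, exchange S (inl i) j = - exchange S (inl j) i;
  rep_column : forall y, exists r,
    [/\ E r, old r = b y, column S b r y &
        {subset pos r ++ neg r <= codom (name_of b)}] }.

Lemma E_wfn r : E r -> old r \notin neg r /\ new r \notin pos r ++ neg r.
Proof.
move=> Er.
have [_ _ ? _ _] := E_wf (E_swap Er); have [_ _ n1 _ _] := E_wf (E_flip Er).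
by have [_ _ n2 _ _] := E_wf (E_swap (E_flip Er)); rewrite mem_cat (negPf n1).
Qed.

Section Rep.
Variables (S : seed F I J) (b : I -> V).
Hypothesis Sb : represented S b.

Lemma rep_mutable i : ~~ frozen (b i).
Proof. by have [r [/E_wf[H _ _ _ _] <- _ _]] := rep_column Sb i. Qed.

Lemma name_of_inj : injective (name_of b).
Proof.
move=> [i|j] [i'|j'] //= Eq.
- have [->//|ii'] := eqVneq i i'; have := rep_compat Sb ii'.
  by rewrite Eq (negPf (A_irr _)).
- by have := rep_mutable i; rewrite Eq fz_frozen.
- by have := rep_mutable i'; rewrite -Eq fz_frozen.
- by rewrite (fz_inj Eq).
Qed.

Lemma rep_extended r : extended_cluster S r = X (name_of b r).
Proof. by case: r => [i|j] /=; [exact: (rep_cluster Sb)|exact: (rep_coefficient Sb)]. Qed.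

Lemma monomial_names (s : seq V) : {subset s <= codom (name_of b)} ->
  \prod_r X (name_of b r) ^+ count_mem (name_of b r) s = monomial X s.
Proof.
elim: s => [|v s IH] sub.
  by rewrite /monomial big_nil; apply: big1 => r _; rewrite expr0.
rewrite /monomial big_cons -[Y in _ * Y]IH; last by move=> w ws; apply: sub; rewrite inE ws orbT.
have /codomP[r0 ->] : v \in codom (name_of b) by apply: sub; rewrite inE eqxx.
under eq_bigr do rewrite /= exprD.
rewrite big_split /=; congr (_ * _); rewrite (bigD1 r0) //= eqxx expr1 big1 ?mulr1 // => r rr0.
by rewrite (inj_eq name_of_inj) eq_sym (negPf rr0) expr0.
Qed.

(** As the names in a seed are distinct and the two monomials have no common
factor, the positive entries of the column are the exponents of one of them. *)
Lemma prod_column (s t : seq V) (c : I + J -> int) :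
  {in s, forall v, v \notin t} -> {subset s <= codom (name_of b)} ->
  (forall r, c r = (count_mem (name_of b r) s)%:Z - (count_mem (name_of b r) t)%:Z) ->
  \prod_(r | 0 < c r) extended_cluster S r ^+ `|c r|%N = monomial X s.
Proof.
move=> st sub cE; rewrite -(monomial_names sub) big_mkcond; apply: eq_bigr => r _.
rewrite rep_extended cE; have [vs|vs] := boolP (name_of b r \in s).
  by have /count_memPn -> := st _ vs; rewrite subr0 ltz_nat -has_count has_pred1 vs.
rewrite (count_memPn vs) ifF //; lia.
Qed.

Lemma cluster_mutate z r : E r -> old r = b z -> column S b r z ->
  {subset pos r ++ neg r <= codom (name_of b)} ->
  cluster (mutate S z) z = X (new r).
Proof.
move=> Er rz col sub; rewrite /= eqxx.
have [_ _ _ dis _] := E_wf Er; have [_ _ _ dis' _] := E_wf (E_swap Er).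
rewrite (prod_column (s := pos r) (t := neg r)) //; last by move=> v vs; apply: sub; rewrite mem_cat vs.
have -> : \prod_(r' | exchange S r' z < 0) extended_cluster S r' ^+ `|exchange S r' z|%N = monomial X (neg r).
  rewrite -(prod_column (s := neg r) (t := pos r) (c := fun r' => - exchange S r' z)) //.
  - by apply: eq_big => [r'|r' _]; rewrite ?oppr_gt0 ?abszN.
  - by move=> v vs; apply: sub; rewrite mem_cat vs orbT.
  - by move=> r'; rewrite col opprB.
by rewrite -(E_holds Er) (rep_cluster Sb) -rz mulrAC mulfV ?E_neq0 // mul1r.
Qed.

Variables (z : I) (r : exrel V).
Hypotheses (Er : E r) (rz : old r = b z) (rsub : {subset pos r ++ neg r <= codom (name_of b)}).

Definition rename i := if i == z then new r else b i.

Lemma rename_name r' : r' != inl z -> name_of rename r' = name_of b r'.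
Proof.
case: r' => [i|//] /=; rewrite /rename; have [->|//] := eqVneq i z.
by rewrite eqxx.
Qed.

(** The name b i is compatible with the whole seed, in particular with [old r] and
with the names in the two monomials of r. *)
Lemma compatible_new i : i != z -> A (b i) (new r) /\ A (new r) (b i).
Proof.
move=> iz; apply: E_link => //; first by rewrite rz; apply: rep_compat Sb _ _ iz.
move=> v /rsub /codomP[[j|j] ->] /= nf; last by rewrite fz_frozen in nf.
have [->|ij] := eqVneq i j; first by left.
by right; apply: rep_compat Sb _ _ ij.
Qed.

Lemma new_fresh : new r \notin codom (name_of b).
Proof.
have [nf _ _ _ _] := E_wf (E_flip Er); have [_ on _ _ _] := E_wf Er.
apply/negP => /codomP[[i|j] E0]; last by rewrite /= E0 fz_frozen in nf.
have [iz|iz] := eqVneq i z; first by rewrite rz E0 iz eqxx in on.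
by have [H _] := compatible_new iz; rewrite E0 /= (negPf (A_irr _)) in H.
Qed.

Lemma codom_rename v : v \in codom (name_of b) -> v != b z -> v \in codom (name_of rename).
Proof.
move=> /codomP[r' ->] vz; apply/codomP; exists r'; rewrite rename_name //.
by apply: contraNneq vz => ->.
Qed.

Lemma codom_new : new r \in codom (name_of rename).
Proof. by apply/codomP; exists (inl z); rewrite /= /rename eqxx. Qed.

(** Relations are recorded up to the swap of their two monomials; the sign s keeps
track of the orientation, so that only arrows in one direction need treatment. *)
Lemma pentagon_column (s : int) y r2 : y != z -> s = 1 \/ s = -1 ->
  E r2 -> old r2 = b y -> {subset pos r2 ++ neg r2 <= codom (name_of b)} ->
  (forall r', exchange S r' z = s *
     ((count_mem (name_of b r') (pos r))%:Z - (count_mem (name_of b r') (neg r))%:Z)) ->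
  (forall r', exchange S r' y = s *
     ((count_mem (name_of b r') (pos r2))%:Z - (count_mem (name_of b r') (neg r2))%:Z)) ->
  b z \in pos r2 ->
  exists r4, [/\ E r4, old r4 = b y, {subset pos r4 ++ neg r4 <= codom (name_of rename)} &
   forall r', exchange (mutate S z) r' y = s *
     ((count_mem (name_of rename r') (pos r4))%:Z - (count_mem (name_of rename r') (neg r4))%:Z)].
Proof.
move=> yz s1 Er2 r2y sub2 colz coly bz.
have [_ _ _ dis uni] := E_wf Er; have [_ _ _ dis2 uni2] := E_wf Er2.
have cz : count_mem (b z) (pos r2) = 1%N by apply: uni2 => //; apply: rep_mutable.
have cz' : count_mem (b z) (neg r2) = 0%N by apply/count_memPn; apply: dis2.
have [bzn bzp] : count_mem (b z) (neg r) = 0%N /\ count_mem (b z) (pos r) = 0%N.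
  have [_ _ + _ _] := E_wf Er; have [+ _] := E_wfn Er; rewrite rz.
  by split; apply/count_memPn.
have byn : old r2 \in neg r.
  have := rep_skew Sb y z; rewrite colz coly /= cz cz' r2y => sk.
  by rewrite -has_pred1 has_count; case: s1 sk => -> ?; lia.
have [||r4 [Er4 r4y /permP perm4]] := E_pentagon Er Er2 _ byn.
- by rewrite rz.
- have sub v : v \in [:: old r, old r2 & pos r ++ neg r ++ pos r2 ++ neg r2] ->
      v \in codom (name_of b).
    rewrite !inE !mem_cat => /orP[/eqP ->|/orP[/eqP ->|]].
    + by rewrite rz; apply/codomP; exists (inl z).
    + by rewrite r2y; apply/codomP; exists (inl y).
    + by rewrite orbA -mem_cat -[X in _ || X]mem_cat => /orP[]; [apply: rsub|apply: sub2].
  move=> v w /sub/codomP[[i ->|j ->]] /sub/codomP[[i' ->|j' ->]] /=; rewrite ?fz_frozen // => _ _.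
  have [->|ii'] := eqVneq i i'; [by left|right; exact: rep_compat Sb _ _ ii'].
have cE v : (count_mem v (neg r4) + (count_mem v (pos r2) - (b z == v)) + count_mem v (pos r) =
      count_mem v (pos r4) + (new r == v) + count_mem v (neg r2))%N.
  have := perm4 (pred1 v); rewrite /= !count_cat /= rz => H.
  have : ((b z == v) <= count_mem v (pos r2))%N.
    by have [<-|//] := eqVneq; rewrite cz.
  by lia.
have [_ _ _ dis4 _] := E_wf Er4.
have dis4' v : v \in neg r4 -> count_mem v (pos r4) = 0%N.
  by move=> v4; apply/count_memPn; apply: contraL v4 => /dis4.
have bznew : (new r == b z) = false by apply/negbTE; have [_ + _ _ _] := E_wf Er; rewrite rz eq_sym.
exists r4; split=> //.
- by rewrite r4y.
- move=> v; rewrite mem_cat => v4.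
  have [->|vnew] := eqVneq v (new r); first exact: codom_new.
  have vnew' : (new r == v) = false by rewrite eq_sym (negPf vnew).
  apply: codom_rename; last first.
    apply: contraTneq v4 => ->; have := cE (b z); rewrite eqxx cz cz' bzp bznew => H.
    have [bn|/count_memPn bn] := boolP (b z \in neg r4).
      have := dis4' _ bn; have : (0 < count_mem (b z) (neg r4))%N by rewrite -has_count has_pred1.
      by move: H; lia.
    by rewrite orbF; apply/count_memPn; lia.
  have pv : forall s, v \in s = (0 < count_mem v s)%N by move=> s'; rewrite -has_count has_pred1.
  have := cE v; rewrite vnew'; case/orP: v4 => v4.
    have /count_memPn -> := dis4 _ v4; rewrite pv in v4 => H.
    have [v2|v2] : (0 < count_mem v (pos r2) \/ 0 < count_mem v (pos r))%N by lia.
      by apply: sub2; rewrite mem_cat pv v2.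
    by apply: rsub; rewrite mem_cat pv v2.
  rewrite (dis4' _ v4) => H; rewrite pv in v4.
  by apply: sub2; rewrite mem_cat orbC pv; lia.
- move=> r'; have [->|r'z] := eqVneq r' (inl z).
    rewrite /= eqxx /= coly /= cz cz' /rename eqxx.
    have := cE (new r); rewrite eqxx eq_sym bznew.
    have /count_memPn -> : new r \notin pos r2.
      by apply: contra new_fresh => H; apply: sub2; rewrite mem_cat H.
    have /count_memPn -> : new r \notin neg r2.
      by apply: contra new_fresh => H; apply: sub2; rewrite mem_cat H orbT.
    have /count_memPn -> : new r \notin pos r.
      by apply: contra new_fresh => H; apply: rsub; rewrite mem_cat H.
    by case: s1 => -> ?; lia.
  rewrite rename_name // /= (negPf r'z) (negPf yz) /=.
  have := cE (name_of b r').
  have -> : (b z == name_of b r') = false.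
    by rewrite eq_sym -[b z]/(name_of b (inl z)) (inj_eq name_of_inj) (negPf r'z).
  have -> : (new r == name_of b r') = false.
    by apply: contraNF new_fresh => /eqP ->; apply: codom_f.
  rewrite coly colz (coly (inl z)) /= cz cz'.
  have : count_mem (name_of b r') (pos r) = 0%N \/ count_mem (name_of b r') (neg r) = 0%N.
    have [/dis v|/count_memPn ->] := boolP (name_of b r' \in pos r); last by left.
    by right; apply/count_memPn.
  by move=> [] ->; case: s1 => -> ?; lia.
Qed.

End Rep.

(** The column at z is reversed; a column at y joined to z is replaced according to
[pentagon_column]; all others remain, since z does not occur in them. *)
Lemma represented_mutate S b z : represented S b -> exists b', represented (mutate S z) b'.
Proof.
move=> Sb; have [r [Er rz colz rsub]] := rep_column Sb z.
exists (rename b z r); split.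
- move=> i; rewrite /rename; have [->|iz] := eqVneq i z; first exact: (cluster_mutate Sb Er).
  by rewrite /= (negPf iz) (rep_cluster Sb).
- by move=> j; rewrite -(rep_coefficient Sb).
- move=> i j ij; rewrite /rename; case: eqVneq => [iz|iz]; case: eqVneq => [jz|jz].
  + by rewrite iz jz eqxx in ij.
  + by have [] := compatible_new Sb Er rz rsub jz.
  + by have [] := compatible_new Sb Er rz rsub iz.
  + exact: rep_compat Sb _ _ ij.
- move=> i j /=; have inlE (i' j' : I) : (inl i' == inl j' :> I + J) = (i' == j') by [].
  rewrite !inlE [(j == z) || _]orbC; case: ifP => _; first by rewrite (rep_skew Sb).
  rewrite (rep_skew Sb z j) (rep_skew Sb z i) (rep_skew Sb i j) !normrN.
  move: (exchange S (inl i) z) (exchange S (inl j) z) => a c.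
  have [->|->] : `|a| = a \/ `|a| = - a by lia.
    have [->|->] : `|c| = c \/ `|c| = - c by lia.
      by rewrite ?(mulrN, mulNr) (mulrC c a); move: (a * c) => m; lia.
    by rewrite ?(mulrN, mulNr) (mulrC c a); move: (a * c) => m; lia.
  have [->|->] : `|c| = c \/ `|c| = - c by lia.
    by rewrite ?(mulrN, mulNr) (mulrC c a); move: (a * c) => m; lia.
  by rewrite ?(mulrN, mulNr) (mulrC c a); move: (a * c) => m; lia.
have [bnr bnr'] := E_wfn Er; have [_ _ bpr _ _] := E_wf Er; rewrite rz in bnr bpr.
have sub_new v : v \in pos r ++ neg r -> v \in codom (name_of (rename b z r)).
  move=> vr; apply: codom_rename; first exact: rsub.
  by apply: contraTneq vr => ->; rewrite mem_cat (negPf bnr) (negPf bpr).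
move=> y; have [->|yz] := eqVneq y z.
  exists (swap (flip r)); split=> //=.
  - exact/E_swap/E_flip.
  - by rewrite /rename eqxx.
  - move=> r' /=; rewrite eqxx orbT colz.
    have [->|r'z] := eqVneq r' (inl z); last by rewrite rename_name // opprB.
    rewrite /= /rename eqxx (count_memPn bnr) (count_memPn bpr).
    by move: bnr'; rewrite mem_cat => /norP[/count_memPn -> /count_memPn ->].
  - by move=> v; rewrite mem_cat orbC -mem_cat; apply: sub_new.
have [r2 [Er2 r2y coly sub2]] := rep_column Sb y.
have [_ by' _ dis2 _] := E_wf Er2.
have ry : rename b z r y = b y by rewrite /rename (negPf yz).
have [bp|bp] := boolP (b z \in pos r2).
  have [|||r4 [Er4 r4y sub4 col4]] :=
    pentagon_column Sb Er rz rsub (s := 1) yz _ Er2 r2y sub2 _ _ bp.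
  - by left.
  - by move=> r'; rewrite mul1r.
  - by move=> r'; rewrite mul1r.
  by exists r4; split=> //; [rewrite ry|move=> r'; rewrite col4 mul1r].
have [bn|bn] := boolP (b z \in neg r2).
  have [|||||r4 [Er4 r4y sub4 col4]] :=
    pentagon_column Sb (E_swap Er) rz _ (s := -1) yz _ (E_swap Er2) r2y _ _ _ bn.
  - by move=> v; rewrite mem_cat orbC -mem_cat; apply: rsub.
  - by right.
  - by move=> v; rewrite mem_cat orbC -mem_cat; apply: sub2.
  - by move=> r'; rewrite mulN1r opprB.
  - by move=> r'; rewrite mulN1r opprB.
  exists (swap r4); split=> /=; [exact: E_swap|by rewrite ry| |].
  - by move=> r'; rewrite col4 mulN1r opprB.
  - by move=> v; rewrite mem_cat orbC -mem_cat; apply: sub4.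
have bzy : exchange S (inl z) y = 0 by rewrite coly (count_memPn bp) (count_memPn bn).
exists r2; split=> //; first by rewrite ry.
- move=> r'; have [->|r'z] := eqVneq r' (inl z).
    rewrite /= eqxx bzy /rename eqxx oppr0.
    have p : new r \notin pos r2 ++ neg r2.
      by apply: contra (new_fresh Sb Er rz rsub); apply: sub2.
    by move: p; rewrite mem_cat => /norP[/count_memPn -> /count_memPn ->].
  rewrite rename_name // /= (negPf r'z) (negPf yz) /= bzy normr0 !mulr0.
  by rewrite (_ : ((0 + 0) %/ 2)%Z = 0) // addr0 coly.
- move=> v v2; apply: codom_rename; first exact: sub2.
  by apply: contraTneq v2 => ->; rewrite mem_cat (negPf bn) (negPf bp).
Qed.

Lemma represented_finite S b (names : seq V) :
  represented S b -> (forall r, E r -> old r \in names) -> finite_type S.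
Proof.
move=> Sb En.
have rep zs : exists b', represented (foldl (@mutate F I J) S zs) b'.
  elim: zs S b Sb => [|z zs IH] T c Tc; first by exists c.
  by have [c' Tc'] := represented_mutate z Tc; apply: (IH _ _ Tc').
apply: (@sub_finite_set _ _ (X @` [set` names])); last exact/finite_image/finite_seq.
move=> f [zs [i ->]]; have [b' Sb'] := rep zs; exists (b' i); last by rewrite (rep_cluster Sb').
by have [r [Er <- _ _]] := rep_column Sb' i; apply: En.
Qed.
End Closure.

Local Close Scope ring_scope.

(** * Tables up to rotation and their verification *)

(** Names are pairs (i, m): the element number m of the orbit number i under
rotation. The functions below avoid the generic boolean operations because these
evaluate both arguments when a program is run by value. *)
Definition name := (nat * nat)%type.

Fixpoint eqnat (m n : nat) : bool :=
  match m, n with 0, 0 => true | S m, S n => eqnat m n | _, _ => false end.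

Definition eqname (v w : name) : bool :=
  let: (i, a) := v in let: (j, b) := w in if eqnat a b then eqnat i j else false.

Fixpoint mem_name (v : name) (s : seq name) : bool :=
  if s is w :: s' then if eqname v w then true else mem_name v s' else false.

Fixpoint rem_name (v : name) (s : seq name) : option (seq name) :=
  if s is w :: s' then
    if eqname v w then Some s'
    else if rem_name v s' is Some t then Some (w :: t) else None
  else None.

Fixpoint diff_names (s t : seq name) : option (seq name) :=
  if t is v :: t' then
    if rem_name v s is Some s' then diff_names s' t' else None
  else Some s.

Definition same_names (s t : seq name) : bool :=
  if diff_names s t is Some [::] then true else false.

Fixpoint all_if (T : Type) (p : T -> bool) (s : seq T) : bool :=
  if s is x :: s' then if p x then all_if p s' else false else true.

Fixpoint has_if (T : Type) (p : T -> bool) (s : seq T) : bool :=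
  if s is x :: s' then if p x then true else has_if p s' else false.

Lemma eqnatE m n : eqnat m n = (m == n).
Proof. by elim: m n => [|m IH] [|n] //=; rewrite IH. Qed.

Lemma eqnameE v w : eqname v w = (v == w).
Proof. by case: v w => [i a] [j b]; rewrite /= !eqnatE xpair_eqE andbC; case: eqP. Qed.

Lemma mem_nameE v s : mem_name v s = (v \in s).
Proof. by elim: s => //= w s IH; rewrite eqnameE inE IH; case: eqP. Qed.

Lemma rem_nameP v s t : rem_name v s = Some t -> perm_eq s (v :: t).
Proof.
elim: s t => //= w s IH t; rewrite eqnameE; case: eqP => [-> [->]|_] //.
case E: (rem_name v s) => [u|//] [<-].
rewrite -(cat1s w s) -[v :: w :: u]/([:: v] ++ [:: w] ++ u) perm_sym perm_catCA /= perm_cons.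
by rewrite perm_sym; apply: IH.
Qed.

Lemma diff_namesP s t u : diff_names s t = Some u -> perm_eq s (t ++ u).
Proof.
elim: t s => [|v t IH] s /=; first by case=> ->.
case E: (rem_name v s) => [s'|//] /IH st.
by apply: perm_trans (rem_nameP E) _; rewrite perm_cons.
Qed.

Lemma same_namesP s t : same_names s t -> perm_eq s t.
Proof.
rewrite /same_names; case E: (diff_names s t) => [[|//]|//] _.
by have := diff_namesP E; rewrite cats0.
Qed.

Lemma all_ifE T (p : T -> bool) s : all_if p s = all p s.
Proof. by elim: s => //= x s ->; case: (p x). Qed.

Lemma has_ifE T (p : T -> bool) s : has_if p s = has p s.
Proof. by elim: s => //= x s ->; case: (p x). Qed.

Section Rotation.
Variable n : nat.
Hypothesis n_gt0 : 0 < n.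

Definition rotate_name (s : nat) (v : name) : name := (v.1, (v.2 + s) %% n).

Definition map_exrel (g : name -> name) (r : exrel name) :=
  Exrel (g (old r)) (g (new r)) (map g (pos r)) (map g (neg r)).

Definition rotate_rel (s : nat) := map_exrel (rotate_name s).

Lemma rotate_nameD s t v : rotate_name t (rotate_name s v) = rotate_name (s + t) v.
Proof. by rewrite /rotate_name /= modnDml addnA. Qed.

Lemma rotate_relD s t r : rotate_rel t (rotate_rel s r) = rotate_rel (s + t) r.
Proof.
case: r => b c P N; rewrite /rotate_rel /map_exrel /= !rotate_nameD -!map_comp.
by congr Exrel; apply: eq_map => v; rewrite /= rotate_nameD.
Qed.

Lemma rotate_name_mod s t : s = t %[mod n] -> rotate_name s =1 rotate_name t.
Proof. by move=> st v; rewrite /rotate_name -modnDmr st modnDmr. Qed.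

Lemma rotate_rel_mod s t : s = t %[mod n] -> rotate_rel s =1 rotate_rel t.
Proof.
move=> st [b c P N]; rewrite /rotate_rel /map_exrel /=.
by congr Exrel; rewrite ?(rotate_name_mod st) //; apply: eq_map; apply: rotate_name_mod.
Qed.

Definition normal (v : name) := v.2 < n.

Lemma rotate_name_normal s v : normal (rotate_name s v).
Proof. by rewrite /normal ltn_mod. Qed.

Lemma rotate_name_full v : normal v -> rotate_name n v = v.
Proof. by case: v => i m; rewrite /normal /rotate_name /= => mn; rewrite modnDr modn_small. Qed.

(* There are N orbits of names, the first f of which are frozen; [reps] represents
the relations up to rotation, exchange of the two sides, and swap of monomials. *)
Variables (f N : nat) (reps : seq (exrel name)).

Definition variants (r : exrel name) := [:: r; flip r; swap r; flip (swap r)].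

Definition variant_reps := flatten (map variants reps).

Definition in_table (r : exrel name) : Prop :=
  exists2 r0, r0 \in variant_reps & exists s, r = rotate_rel s r0.

Definition base_table : seq (seq (exrel name)) :=
  let all := variant_reps in
  map (fun i => map (fun r => rotate_rel (n - (old r).2 %% n) r)
    (filter (fun r => eqnat (old r).1 i) all)) (iota 0 N).

Definition full_table (T0 : seq (seq (exrel name))) : seq (seq (seq (exrel name))) :=
  map (fun l => map (fun m => map (rotate_rel m) l) (iota 0 n)) T0.

Definition frozen (v : name) := v.1 < f.
Definition mutables (s : seq name) := filter (fun v => ~~ frozen v) s.
Definition support (r : exrel name) := pos r ++ neg r.

Definition lookup (T : seq (seq (seq (exrel name)))) (v : name) :=
  nth [::] (nth [::] T v.1) v.2.

(** Two names are joined if they occur together in the part of a seed that some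
relation requires: its old name and the mutable names in its monomials. Only the
pairs ((i, 0), (j, d)) are stored, the others being rotations of these. *)
Definition cooccurrences (T0 : seq (seq (exrel name))) : seq (seq (seq bool)) :=
  map (fun i =>
    let mark := flatten (map (fun r => mutables (support r)) (nth [::] T0 i) ++
      flatten (map (map (fun r => let s := mutables (support r) in
        flatten (map (fun v => map (rotate_name (n - v.2)) (old r :: s))
                     (filter (fun v => eqnat v.1 i) s)))) T0)) in
    map (fun j => map (fun d => if eqname (i, 0) (j, d) then false
                                else mem_name (j, d) mark) (iota 0 n)) (iota 0 N))
  (iota 0 N).

Variable B : seq (seq (seq bool)).

Definition difference (a b : nat) : nat := if b < a then b + n - a else b - a.

Definition joined (v w : name) : bool :=
  nth false (nth [::] (nth [::] B v.1) w.1) (difference v.2 w.2).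

Definition compatible (v w : name) := [&& v != w, normal v, normal w & joined v w].

Definition weakly_joined (v w : name) := if eqname v w then true else joined v w.

Definition well_formed (r : exrel name) :=
  [&& ~~ frozen (old r), ~~ eqname (old r) (new r), ~~ mem_name (old r) (pos r),
      all (fun v => ~~ mem_name v (neg r)) (pos r),
      uniq (mutables (pos r)), (old r).1 < N & all (fun v => v.1 < N) (pos r)].

Definition link_check (r : exrel name) : bool :=
  let M := mutables (support r) in
  all_if (fun j => all_if (fun m => let w := (j, m) in
    if joined w (old r) then
      if all_if (weakly_joined w) M then
        [&& ~~ eqname w (new r), joined w (new r) & joined (new r) w]
      else true
    else true) (iota 0 n)) (iota 0 N).

Variable T : seq (seq (seq (exrel name))).

(** Either the mutated column is in the table, or r and r2 are not columns of a
common seed because two of the names involved are not joined. *)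
Definition pentagon_check (r r2 : exrel name) : bool :=
  let lhs := old r :: new r :: neg r2 in let rhs := pos r2 ++ pos r in
  if has_if (fun r4 => same_names (neg r4 ++ rhs) (pos r4 ++ lhs)) (lookup T (old r2))
  then true
  else let M := mutables (old r :: old r2 :: support r ++ support r2) in
    ~~ all_if (fun v => all_if (weakly_joined v) M) M.

(** It is enough to let r2 (and the single relation) start at an element (i, 0) of
its orbit, as the conditions are invariant under rotation. *)
Definition closed_check : bool :=
  all_if (fun i => all_if (fun r2 =>
    if well_formed r2 then
      if link_check r2 then
        all_if (fun b => all_if (fun r =>
          if mem_name (old r2) (neg r) then pentagon_check r r2 else true) (lookup T b))
        (mutables (pos r2))
      else false
    else false) (lookup T (i, 0))) (iota 0 N).

Hypothesis T_def : T = full_table base_table.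
Hypothesis T_closed : closed_check.

Lemma in_table_rotate s r : in_table r -> in_table (rotate_rel s r).
Proof. by move=> [r0 r0v [t ->]]; exists r0 => //; exists (t + s); rewrite rotate_relD. Qed.

Lemma in_table_flip r : in_table r -> in_table (flip r).
Proof.
move=> [r0 /flattenP[l /mapP[r1 r1r ->] r0l] [t ->]]; exists (flip r0); last by exists t.
apply/flattenP; exists (variants r1); first exact: map_f.
by move: r0l; rewrite !inE; case/or4P => /eqP ->; case: r1 {r1r} => b c P Q; rewrite eqxx ?orbT.
Qed.

Lemma in_table_swap r : in_table r -> in_table (swap r).
Proof.
move=> [r0 /flattenP[l /mapP[r1 r1r ->] r0l] [t ->]]; exists (swap r0); last by exists t.
apply/flattenP; exists (variants r1); first exact: map_f.
by move: r0l; rewrite !inE; case/or4P => /eqP ->; case: r1 {r1r} => b c P Q; rewrite eqxx ?orbT.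
Qed.

Lemma in_table_full r : in_table r -> rotate_rel n r = r.
Proof.
by move=> [r0 _ [s ->]]; rewrite rotate_relD; apply: rotate_rel_mod; rewrite modnDr.
Qed.

Lemma in_table_normal r : in_table r ->
  [/\ normal (old r), normal (new r), all normal (pos r) & all normal (neg r)].
Proof.
move=> [r0 _ [s ->]]; split; try exact: rotate_name_normal.
- by apply/allP => _ /mapP[v _ ->]; apply: rotate_name_normal.
- by apply/allP => _ /mapP[v _ ->]; apply: rotate_name_normal.
Qed.

Lemma lookup_full i m : i < N -> m < n ->
  lookup T (i, m) = map (rotate_rel m) (map (fun r => rotate_rel (n - (old r).2 %% n) r)
    (filter (fun r => eqnat (old r).1 i) variant_reps)).
Proof.
move=> iN mn; rewrite T_def /lookup /full_table /base_table /=.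
by rewrite (nth_map [::]) ?size_map ?size_iota // (nth_map 0) ?size_iota // nth_iota //
  (nth_map 0) ?size_iota // nth_iota.
Qed.

Lemma mem_lookup r : in_table r -> (old r).1 < N -> r \in lookup T (old r).
Proof.
move=> [r0 r0v [s ->]] /=; case E: (old r0) => [i m0] /= iN.
rewrite lookup_full // ?ltn_mod //; set m := _ %% n.
apply/mapP; exists (rotate_rel (n - m0 %% n) r0).
  by apply/mapP; exists r0; rewrite ?E // mem_filter E /= eqnatE eqxx.
rewrite rotate_relD; apply: rotate_rel_mod; rewrite /m modnDmr.
have mn : m0 %% n <= n by rewrite ltnW // ltn_mod.
rewrite (_ : n - m0 %% n + (m0 + s) = (m0 %/ n).+1 * n + s) ?modnMDl //.
by rewrite mulSn {2}(divn_eq m0 n); lia.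
Qed.

Lemma lookupP r i m : i < N -> m < n -> r \in lookup T (i, m) -> in_table r /\ old r = (i, m).
Proof.
move=> iN mn; rewrite lookup_full // => /mapP[_ /mapP[r0 + ->] ->].
rewrite mem_filter eqnatE => /andP[/eqP r0i r0v]; split.
  by exists r0 => //; exists (n - (old r0).2 %% n + m); rewrite rotate_relD.
rewrite rotate_relD /= /rotate_name r0i; congr (_, _).
have mn' : (old r0).2 %% n <= n by rewrite ltnW // ltn_mod.
set m0 := (old r0).2 in mn' *.
rewrite (_ : m0 + (n - m0 %% n + m) = (m0 %/ n).+1 * n + m) ?modnMDl ?(modn_small mn) //.
have := divn_eq m0 n; rewrite mulSn; lia.
Qed.

Lemma difference_rotate s v w : normal v -> normal w ->
  difference (rotate_name s v).2 (rotate_name s w).2 = difference v.2 w.2.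
Proof.
case: v w => [i a] [j b]; rewrite /normal /difference /= => an bn.
have D x : x < n -> (x + s) %% n = if x + s %% n < n then x + s %% n else x + s %% n - n.
  move=> xn; have sn : s %% n < n by rewrite ltn_mod.
  rewrite -modnDmr; case: ifP => [lt|ge]; first by rewrite modn_small.
  have le : n <= x + s %% n by rewrite leqNgt ge.
  by rewrite -{1}(subnK le) modnDr modn_small //; lia.
have sn : s %% n < n by rewrite ltn_mod.
rewrite (D _ an) (D _ bn); move: (s %% n) sn => t tn.
by case: (ltnP (a + t) n) => ?; case: (ltnP (b + t) n) => ?; do 2?[case: ltnP => ?]; lia.
Qed.

Lemma joined_rotate s v w : normal v -> normal w -> joined (rotate_name s v) (rotate_name s w) = joined v w.
Proof. by move=> vn wn; rewrite /joined difference_rotate. Qed.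

Lemma weakly_joinedE v w : weakly_joined v w = (v == w) || joined v w.
Proof. by rewrite /weakly_joined eqnameE; case: eqP. Qed.

Hypothesis B_size : size B <= N.
Hypothesis reps_old : all (fun r => (old r).1 < N) variant_reps.

Lemma in_table_old r : in_table r -> (old r).1 < N.
Proof. by move=> [r0 /(allP reps_old) ? [s ->]]. Qed.

Lemma to_base r : in_table r -> exists2 t, t <= n & (rotate_name t (old r)).2 = 0.
Proof.
move=> /in_table_normal[on _ _ _]; exists (n - (old r).2); first exact: leq_subr.
by rewrite /= subnKC ?modnn // ltnW.
Qed.

Lemma in_table_back t r : t <= n -> in_table r -> rotate_rel (n - t) (rotate_rel t r) = r.
Proof. by move=> tn Er; rewrite rotate_relD subnKC // in_table_full. Qed.

Lemma closed_base r : in_table r -> (old r).2 = 0 ->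
  [/\ well_formed r, link_check r &
    forall r', in_table r' -> ~~ frozen (old r') -> old r' \in pos r -> old r \in neg r' ->
      pentagon_check r' r].
Proof.
move=> Er r0; have rN := in_table_old Er.
have rE : old r = ((old r).1, 0) by case: (old r) r0 => ? ? /= ->.
have rT : r \in lookup T ((old r).1, 0) by rewrite -rE; exact: mem_lookup.
move: T_closed; rewrite /closed_check all_ifE => /allP/(_ (old r).1).
rewrite mem_iota rN => /(_ isT); rewrite all_ifE => /allP/(_ _ rT).
case: ifP => // wf; case: ifP => // lk; rewrite all_ifE => /allP H.
split=> // r' Er' nf rr' r'r.
have := H (old r'); rewrite mem_filter nf rr' => /(_ isT); rewrite all_ifE => /allP/(_ r').
have -> : r' \in lookup T (old r') by apply: mem_lookup => //; apply: in_table_old.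
by rewrite mem_nameE r'r; apply.
Qed.

Lemma table_well_formed r : in_table r ->
  [/\ ~~ frozen (old r), old r != new r, old r \notin pos r, {in pos r, forall v, v \notin neg r}
    & {in pos r, forall v, ~~ frozen v -> count_mem v (pos r) = 1%N}].
Proof.
move=> Er; have [t tn t0] := to_base Er.
have [/and5P[fr on op dis /and3P[un _ _]] _ _] := closed_base (in_table_rotate t Er) t0.
rewrite eqnameE in on; rewrite mem_nameE in op.
split=> //.
- by apply: contraNneq on => /= ->.
- by apply: contra op => /= op; apply: map_f.
- move=> v vp; have := allP dis (rotate_name t v) (map_f _ vp).
  by rewrite mem_nameE; apply: contra => vn; apply: map_f.
- move=> v vp nf; apply/eqP; rewrite eqn_leq -has_count has_pred1 vp andbT.
  have <- : count_mem (rotate_name t v) (mutables (pos (rotate_rel t r))) = 1%N.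
    by rewrite count_uniq_mem // mem_filter map_f // andbT nf.
  rewrite /mutables count_filter /= count_map.
  by apply: sub_count => w /= /eqP ->; rewrite eqxx.
Qed.

Lemma table_link r w : in_table r -> compatible w (old r) ->
  (forall v, v \in pos r ++ neg r -> ~~ frozen v -> w = v \/ compatible w v) ->
  compatible w (new r) /\ compatible (new r) w.
Proof.
move=> Er wr ws; have [t tn t0] := to_base Er.
have [on nn pn gn] := in_table_normal Er.
have [_ wn _ _] := and4P wr.
have [_ lk _] := closed_base (in_table_rotate t Er) t0.
have wN : w.1 < N.
  move: wr => /and4P[_ _ _]; rewrite /joined; case: ltnP => // Nw.
  by rewrite (nth_default [::] (leq_trans B_size Nw)) !nth_nil.
have back v : normal v -> rotate_name (n - t) (rotate_name t v) = v.
  by move=> vn; rewrite rotate_nameD subnKC // rotate_name_full.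
move: lk; rewrite /link_check all_ifE => /allP/(_ w.1); rewrite mem_iota wN => /(_ isT).
have dn : (rotate_name t w).2 < n by exact: rotate_name_normal.
rewrite all_ifE => /allP/(_ (rotate_name t w).2); rewrite mem_iota dn => /(_ isT).
have wE : (w.1, (rotate_name t w).2) = rotate_name t w by [].
rewrite wE joined_rotate //; have /and4P[_ _ _ ->] := wr.
rewrite all_ifE ifT; last first.
  apply/allP => v; rewrite mem_filter => /andP[vf].
  rewrite /support /= -map_cat => /mapP[u us uE]; rewrite uE in vf *.
  have un : normal u.
    by move: us; rewrite mem_cat => /orP[/(allP pn)|/(allP gn)].
  rewrite weakly_joinedE joined_rotate //.
  have [<-|/and4P[_ _ _ ->]] := ws u us vf; first by rewrite eqxx.
  by rewrite orbT.
rewrite eqnameE !joined_rotate // => /and3P[wnew j1 j2].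
have wnew' : w != new r by apply: contraNneq wnew => ->.
by rewrite /compatible wnew' eq_sym wnew' wn nn j1 j2.
Qed.

Lemma table_pentagon r r2 : in_table r -> in_table r2 ->
  old r \in pos r2 -> old r2 \in neg r ->
  compatible_list compatible frozen [:: old r, old r2 & pos r ++ neg r ++ pos r2 ++ neg r2] ->
  exists r4, [/\ in_table r4, old r4 = old r2 &
    perm_eq (neg r4 ++ pos r2 ++ pos r) (old r :: pos r4 ++ new r :: neg r2)].
Proof.
move=> Er Er2 rr2 r2r comp; have [t tn t0] := to_base Er2.
have [on nn pn gn] := in_table_normal Er; have [on2 nn2 pn2 gn2] := in_table_normal Er2.
have [nf _ _ _ _] := table_well_formed Er.
have [_ _ H] := closed_base (in_table_rotate t Er2) t0.
have := H _ (in_table_rotate t Er) nf (map_f _ rr2) (map_f _ r2r).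
rewrite /pentagon_check has_ifE; case: ifP => [/hasP[r4 r4T /same_namesP p4] _|_].
  have [Er4 r4o] := lookupP (in_table_old (in_table_rotate t Er2)) (rotate_name_normal t (old r2)) r4T.
  have back := in_table_back tn.
  exists (rotate_rel (n - t) r4); split; first exact: in_table_rotate.
    by rewrite /= r4o -[RHS](congr1 (@old _) (back _ Er2)).
  set r' := rotate_rel t r in p4; set r2' := rotate_rel t r2 in p4.
  rewrite -(back _ Er) -(back _ Er2) -/r' -/r2'.
  have := perm_map (rotate_name (n - t)) p4; rewrite !map_cat /= => /perm_trans; apply.
  by rewrite -cat1s perm_catCA.
case/negP; rewrite all_ifE; apply/allP => v; rewrite mem_filter => /andP[vf vM].
rewrite all_ifE; apply/allP => w; rewrite mem_filter => /andP[wf wM].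
have un u : u \in [:: old (rotate_rel t r), old (rotate_rel t r2)
                     & support (rotate_rel t r) ++ support (rotate_rel t r2)] ->
    exists2 u', u = rotate_name t u' & normal u' /\
      u' \in [:: old r, old r2 & pos r ++ neg r ++ pos r2 ++ neg r2].
  rewrite /support /= -!map_cat -!map_cons -catA => /mapP[u' u's ->]; exists u' => //; split=> //.
  move: u's; rewrite !inE !mem_cat => /orP[/eqP -> //|/orP[/eqP ->//|]].
  by case/or4P => [/(allP pn)|/(allP gn)|/(allP pn2)|/(allP gn2)].
have [v' vE [vn v's]] := un _ vM; have [w' wE [wn w's]] := un _ wM.
rewrite vE wE weakly_joinedE joined_rotate //.
have vf' : ~~ frozen v' by rewrite vE in vf.
have wf' : ~~ frozen w' by rewrite wE in wf.
by have [->|/and4P[_ _ _ ->]] := comp v' w' v's w's vf' wf'; rewrite ?eqxx ?orbT.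
Qed.

End Rotation.

(** * Derivation of the exchange relations *)

(** A derivation lists relations up to rotation, in an order in which each of them
is a three-term Plücker relation, or the definition of a new orbit of names, or
follows from three earlier relations by the pentagon identity. A relation already
known is referred to by its number, a rotation and an orientation. *)
Inductive step :=
| Plucker of nat & nat & nat & nat & nat
| Define of name & name & seq name & seq name
| Pentagon of nat * nat * nat & nat * nat * nat & nat * nat * nat.

(** In a pentagon a_1, ..., a_5 the relation number i exchanges a_(i-1) and a_(i+1)
and has a_i in its first monomial: a_(i-1) a_(i+1) = a_i P_i + Q_i. Relations
2, 3, 4 imply relation 1, with Q_1 = P_3 P_4 and P_1 given by Q_4 = P_1 P_2, if
moreover Q_3 P_4 = Q_2 P_1. *)
Definition pentagon_step (r2 r3 r4 : exrel name) : option (exrel name) :=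
  if eqname (new r2) (old r4) then
    if rem_name (old r3) (pos r2) is Some P2 then
      if rem_name (new r2) (pos r3) is Some P3 then
        if rem_name (new r3) (pos r4) is Some P4 then
          if diff_names (neg r4) P2 is Some P1 then
            if same_names (neg r3 ++ P4) (neg r2 ++ P1) then
              Some (Exrel (new r4) (old r3) (old r2 :: P1) (P3 ++ P4))
            else None
          else None
        else None
      else None
    else None
  else None.

Section Monomials.
Local Open Scope ring_scope.
Variables (F : fieldType).
Implicit Types (X : name -> F) (r : exrel name) (s t : seq name).

Lemma monomial_perm X s t : perm_eq s t -> monomial X s = monomial X t.
Proof. exact: perm_big. Qed.

Lemma monomial_cat X s t : monomial X (s ++ t) = monomial X s * monomial X t.
Proof. exact: big_cat. Qed.

Lemma monomial_cons X v s : monomial X (v :: s) = X v * monomial X s.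
Proof. exact: big_cons. Qed.

Lemma monomial_map X g s : monomial X (map g s) = monomial (X \o g) s.
Proof. exact: big_map. Qed.

Lemma eq_monomial X Y s : {in s, X =1 Y} -> monomial X s = monomial Y s.
Proof. by move=> XY; apply: eq_big_seq. Qed.

Lemma holds_map X g r : holds X (map_exrel g r) <-> holds (X \o g) r.
Proof. by rewrite /holds /= !monomial_map. Qed.

Lemma holds_flip X r : holds X (flip r) <-> holds X r.
Proof. by rewrite /holds /= mulrC. Qed.

Lemma holds_swap X r : holds X (swap r) <-> holds X r.
Proof. by rewrite /holds /= addrC. Qed.

(** Multiplied by a_3, relation 1 follows by substituting relations 4, 3 and 2 one
after the other; a_3 can be cancelled. *)
Lemma pentagon_step_holds X r2 r3 r4 r1 : pentagon_step r2 r3 r4 = Some r1 ->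
  X (new r2) != 0 -> holds X r2 -> holds X r3 -> holds X r4 -> holds X r1.
Proof.
rewrite /pentagon_step eqnameE; case: eqP => // a34.
case E2: rem_name => [P2|//]; case E3: rem_name => [P3|//]; case E4: rem_name => [P4|//].
case E1: diff_names => [P1|//]; case: ifP => // /same_namesP EQ [<-] a3.
rewrite /holds /= !monomial_cat monomial_cons.
rewrite (monomial_perm X (rem_nameP E2)) (monomial_perm X (rem_nameP E3)).
rewrite (monomial_perm X (rem_nameP E4)) (monomial_perm X (diff_namesP E1)) !monomial_cons monomial_cat -a34.
have := monomial_perm X EQ; rewrite !monomial_cat.
move: (X (old r2)) (X (old r3)) (X (new r2)) (X (new r3)) (X (new r4)) a3 => a1 a2 a3 a4 a5 a3n.
move: (monomial X P1) (monomial X P2) (monomial X P3) (monomial X P4) => p1 p2 p3 p4.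
move: (monomial X (neg r2)) (monomial X (neg r3)) => q2 q3 Eq H2 H3 H4.
apply: (mulfI a3n).
have -> : a3 * (a5 * a2) = a2 * (a3 * a5) by ring.
rewrite H4.
have -> : a2 * (a4 * p4 + p2 * p1) = (a2 * a4) * p4 + p1 * p2 * a2 by ring.
rewrite H3.
have -> : a3 * (a1 * p1 + p3 * p4) = (a1 * a3) * p1 + a3 * p3 * p4 by ring.
rewrite H2.
have -> : (a3 * p3 + q3) * p4 + p1 * p2 * a2 = a3 * p3 * p4 + q3 * p4 + p1 * p2 * a2 by ring.
by rewrite Eq; ring.
Qed.

End Monomials.

Definition variant (f : nat) (r : exrel name) : exrel name :=
  match f with 0 => r | 1 => flip r | 2 => swap r | _ => flip (swap r) end.

Section Derivation.
Variables (n q : nat) (triples : seq (nat * nat * nat)).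
Hypothesis n_gt0 : 0 < n.

(** Rotation of names by one step is rotation of the n * q columns by q steps. The
choice q = 3 for six columns makes all orbits free. *)
Definition shift u x := (x + u) %% (n * q).

(** The orbits that consist of Plücker coordinates come first; [triples] lists the
column sets of their elements number 0. *)
Definition triple_of (v : name) : seq nat :=
  let: (a, b, c) := nth (0, 0, 0) triples v.1 in
  map (shift (v.2 * q)) [:: a; b; c].

Definition plucker_name (t : seq nat) : name :=
  let names := [seq (i, m) | i <- iota 0 (size triples), m <- iota 0 n] in
  nth (0, 0) names (find (fun v => perm_eq (triple_of v) t) names).

Definition names_triple (t : seq nat) :=
  [&& (plucker_name t).1 < size triples, (plucker_name t).2 < n &
      perm_eq (triple_of (plucker_name t)) t].

Definition three_term (e a b c d : nat) : exrel name :=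
  Exrel (plucker_name [:: a; c; e]) (plucker_name [:: b; d; e])
    [:: plucker_name [:: a; b; e]; plucker_name [:: c; d; e]]
    [:: plucker_name [:: a; d; e]; plucker_name [:: b; c; e]].

Definition pick (known : seq (exrel name)) (x : nat * nat * nat) :=
  let: (i, s, f) := x in variant f (rotate_rel n s (nth (Exrel (0, 0) (0, 0) [::] [::]) known i)).

Variable N : nat.

Definition run_step (known : seq (exrel name)) (c : step) : option (exrel name) :=
  match c with
  | Plucker e a b c d =>
    if [&& a < b, b < c, c < d, d < n * q, e < n * q, e \notin [:: a; b; c; d] &
      all names_triple [:: [:: a; c; e]; [:: b; d; e]; [:: a; b; e]; [:: c; d; e]; [:: a; d; e]; [:: b; c; e]]]
    then Some (three_term e a b c d) else None
  | Define b c P Q => Some (Exrel b c P Q)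
  | Pentagon x y z =>
    if [&& x.1.1 < size known, y.1.1 < size known, z.1.1 < size known & (new (pick known x)).1 < N] then
      pentagon_step (pick known x) (pick known y) (pick known z)
    else None
  end.

Fixpoint run (known : seq (exrel name)) (cs : seq step) : option (seq (exrel name)) :=
  if cs is c :: cs' then
    if run_step known c is Some r then run (rcons known r) cs' else None
  else Some known.

Definition definitions (cs : seq step) : seq (exrel name) :=
  pmap (fun c => if c is Define b c P Q then Some (Exrel b c P Q) else None) cs.

Fixpoint definitions_ok (i : nat) (rs : seq (exrel name)) : bool :=
  if rs is r :: rs' then
    [&& new r == (i, 0), (old r).1 < i, all (fun v => v.1 < i) (pos r ++ neg r)
      & definitions_ok i.+1 rs']
  else true.

Local Open Scope ring_scope.
Variables (F : fieldType) (P : F -> Prop).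
Hypotheses (P1 : P 1) (PD : forall x y, P x -> P y -> P (x + y))
  (PM : forall x y, P x -> P y -> P (x * y)) (PV : forall x, P x -> P x^-1)
  (Pneq0 : forall x, P x -> x != 0).

Definition holds_all (X : name -> F) r := forall s, holds (X \o rotate_name n s) r.

(** A definition of (i, 0) uses names from earlier orbits only; its rotations define
the whole orbit i. *)
Lemma define_names (rs : seq (exrel name)) i (X0 : name -> F) :
  definitions_ok i rs -> (forall v, (v.1 < i)%N -> P (X0 v)) ->
  exists X, [/\ forall v, (v.1 < i)%N -> X v = X0 v,
    forall v, (v.1 < i + size rs)%N -> P (X v) &
    {in rs, forall r, holds_all X r}].
Proof.
elim: rs i X0 => [|r rs IH] i X0 /=.
  by move=> _ P0; exists X0; split=> // v; rewrite addn0; apply: P0.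
move=> /and4P[/eqP rn ro rs_lt ok] P0.
pose val s :=
  (monomial (X0 \o rotate_name n s) (pos r) + monomial (X0 \o rotate_name n s) (neg r))
  / X0 (rotate_name n s (old r)).
pose X1 v := if v.1 == i then val v.2 else X0 v.
have Pmon (s : nat) t : all (fun v : name => v.1 < i)%N t -> P (monomial (X0 \o rotate_name n s) t).
  elim: t => [|v t IHt]; first by rewrite /monomial big_nil.
  by move=> /= /andP[vi ti]; rewrite monomial_cons; apply: PM; [apply: P0|apply: IHt].
have [rp rq] : all (fun v : name => v.1 < i)%N (pos r) /\ all (fun v : name => v.1 < i)%N (neg r).
  by move: rs_lt; rewrite all_cat => /andP.
have P1' v : (v.1 < i.+1)%N -> P (X1 v).
  rewrite /X1 ltnS leq_eqVlt; case: eqP => [_ _|_ /= vi]; last exact: P0.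
  by apply: PM; [apply: PD; apply: Pmon|apply: PV; apply: P0].
have [X [XX1 PX HX]] := IH i.+1 X1 ok P1'.
have XX0 v : (v.1 < i)%N -> X v = X0 v.
  by move=> vi; rewrite XX1 ?ltnS 1?ltnW // /X1 ltn_eqF.
exists X; split=> //; first by move=> v; rewrite addnS -addSn; apply: PX.
move=> r'; rewrite inE => /orP[/eqP -> s|]; last exact: HX.
have mE t : all (fun v : name => v.1 < i)%N t ->
    monomial (X \o rotate_name n s) t = monomial (X0 \o rotate_name n s) t.
  by move=> /allP ti; apply: eq_monomial => v /ti vi /=; apply: XX0.
have oE : X (rotate_name n s (old r)) = X0 (rotate_name n s (old r)) by apply: XX0.
rewrite /holds /= !mE // oE rn XX1 //= /X1 /= eqxx /val add0n.
have sE : rotate_name n (s %% n) =1 rotate_name n s by apply: rotate_name_mod; rewrite modn_mod.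
rewrite sE mulrCA mulfV ?mulr1 //; last by apply/Pneq0/P0.
by congr (_ + _); apply: eq_monomial => v _ /=; rewrite sE.
Qed.

Variables (pl : seq nat -> F) (X : name -> F).
Hypothesis pl_perm : forall s t, perm_eq s t -> pl s = pl t.
Hypothesis pl_three_term : forall u e a b c d,
  (a < b)%N -> (b < c)%N -> (c < d)%N -> (d < n * q)%N -> (e < n * q)%N ->
  e \notin [:: a; b; c; d] ->
  let p x y z := pl (map (shift u) [:: x; y; z]) in
  p a c e * p b d e = p a b e * p c d e + p a d e * p b c e.
Hypothesis X_pl : forall v, (v.1 < size triples)%N -> X v = pl (triple_of v).
Hypothesis X_neq0 : forall v, (v.1 < N)%N -> X v != 0.

Lemma triple_of_rotate s v : triple_of (rotate_name n s v) = map (shift (s * q)) (triple_of v).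
Proof.
rewrite /triple_of /=; case: (nth _ _ _) => [[a b] c] /=.
have E x : shift ((v.2 + s) %% n * q) x = shift (s * q) (shift (v.2 * q) x).
  by rewrite /shift modnDml muln_modl modnDmr mulnDl addnA.
by rewrite !E.
Qed.

Lemma X_plucker_name s t : names_triple t ->
  X (rotate_name n s (plucker_name t)) = pl (map (shift (s * q)) t).
Proof.
move=> /and3P[lt _ pt]; rewrite X_pl // triple_of_rotate.
by apply: pl_perm; apply: perm_map.
Qed.

Lemma holds_all_variant f r : holds_all X r -> holds_all X (variant f r).
Proof.
move=> H s; have := H s; case: f => [|[|[|f]]] //= Hs.
- exact/holds_flip.
- exact/holds_swap.
- exact/holds_flip/holds_swap.
Qed.

Lemma holds_all_rotate s r : holds_all X r -> holds_all X (rotate_rel n s r).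
Proof.
move=> H t; apply/holds_map.
have -> : (X \o rotate_name n t) \o rotate_name n s = X \o rotate_name n (s + t).
  by apply/funext => v; rewrite /= rotate_nameD.
exact: H.
Qed.

Lemma run_step_holds known c r : (forall r', r' \in known -> holds_all X r') ->
  (forall b b' P' Q, c = Define b b' P' Q -> holds_all X (Exrel b b' P' Q)) ->
  run_step known c = Some r -> holds_all X r.
Proof.
move=> Hk; case: c => [e a b c d|b b' P' Q|x y z] Hd.
- rewrite /run_step; case: ifP => // /and5P[ab bc cd dn /and3P[en eabcd tr]] [<-] s.
  move: tr; rewrite /= => /and5P[t1 t2 t3 t4 /and3P[t5 t6 _]].
  rewrite /holds /three_term /= !monomial_cons /monomial !big_nil !mulr1 /= !X_plucker_name //.
  exact: pl_three_term.
- by move=> [<-]; apply: Hd.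
- rewrite /run_step; case: ifP => // /and4P[xk yk zk xN] H s.
  have Hpick w : (w.1.1 < size known)%N -> holds_all X (pick known w).
    case: w => [[i t] f] /= ik; apply: holds_all_variant; apply: holds_all_rotate.
    by apply: Hk; apply: mem_nth.
  by apply: (pentagon_step_holds H); rewrite /= ?X_neq0 //; apply: Hpick.
Qed.

Lemma run_holds known cs reps : (forall r, r \in known -> holds_all X r) ->
  {in definitions cs, forall r, holds_all X r} ->
  run known cs = Some reps -> {in reps, forall r, holds_all X r}.
Proof.
elim: cs known => [|c cs IH] known Hk Hd /=; first by case=> <-.
case E: run_step => [r|//]; apply: IH => [r'|r' r'd].
  rewrite mem_rcons inE => /orP[/eqP ->|]; last exact: Hk.
  apply: run_step_holds E => // b b' P' Q cE.
  by apply: Hd; rewrite cE /= inE eqxx.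
by apply: Hd; rewrite /definitions /=; case: c {E} => *; rewrite /= ?inE ?r'd ?orbT.
Qed.

End Derivation.

Local Open Scope ring_scope.

(** * Three-term Plücker relations *)

Section ThreeTerm.
Variables (C : numFieldType) (n : nat).
Local Notation CR := (coordinate_ring C 3 n).

(** The determinant of columns x, y, z, in this order. *)
Definition bracket (A : 'M[C]_(3, n)) (x y z : 'I_n) : C :=
  let r0 := ord0 in let r1 := lift ord0 ord0 in let r2 := lift ord0 (lift ord0 ord0) in
  A r0 x * (A r1 y * A r2 z - A r1 z * A r2 y)
  - A r0 y * (A r1 x * A r2 z - A r1 z * A r2 x)
  + A r0 z * (A r1 x * A r2 y - A r1 y * A r2 x).

Lemma kminor3 (A : 'M[C]_(3, n)) (x y z : 'I_n) (K : ksubset 3 n) :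
  (x < y)%N -> (y < z)%N -> val K = [set x; y; z]%SET -> kminor A K = bracket A x y z.
Proof.
move=> xy yz KE.
have eK : enum (val K) = [:: x; y; z].
  pose lt := relpre (val : 'I_n -> nat) ltn.
  apply: (@irr_sorted_eq _ lt) => //.
  - by move=> a b c; apply: ltn_trans.
  - by move=> a; rewrite /lt /= ltnn.
  - rewrite /enum_mem; apply: sorted_filter; first by move=> a b c; apply: ltn_trans.
    by rewrite -enumT -sorted_map val_enum_ord iota_ltn_sorted.
  - by rewrite /= /lt /= xy yz.
  - by move=> a; rewrite mem_enum KE !inE orbA.
rewrite /kminor; set f := fun a : 'I_3 => enum_val _.
have fE i : f i = nth x [:: x; y; z] i by rewrite /f (enum_val_nth x) eK.
rewrite (expand_det_row _ ord0) !big_ord_recl big_ord0 /cofactor.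
rewrite !(expand_det_row _ ord0) !big_ord_recl !big_ord0 /cofactor !det_mx11 !mxE !fE /=.
by rewrite /bracket /bump /=; ring.
Qed.

Definition plucker3 (x y z : 'I_n) : {fraction CR} := plucker C 3 [set x; y; z]%SET.

Lemma plucker3_bracket (x y z : 'I_n) : (x < y)%N -> (y < z)%N ->
  exists2 p : CR, plucker3 x y z = tofrac p & forall A, eval_at A p = bracket A x y z.
Proof.
move=> xy yz; rewrite /plucker3.
have cK : #|[set x; y; z]%SET| == 3.
  rewrite -finset.setUA !cardsU1 !inE cards1 negb_or -!val_eqE /=.
  by rewrite !(ltn_eqF xy) (ltn_eqF yz) (ltn_eqF (ltn_trans xy yz)).
rewrite /plucker insubT; eexists; first by reflexivity.
move=> A; rewrite eval_at_pi mevalXU enum_rankK.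
exact: kminor3.
Qed.

Lemma three_term_frac (p1 p2 p3 p4 p5 p6 : CR) :
  (forall A : 'M[C]_(3, n), eval_at A p1 * eval_at A p2 =
     eval_at A p3 * eval_at A p4 + eval_at A p5 * eval_at A p6) ->
  (tofrac p1 * tofrac p2 = tofrac p3 * tofrac p4 + tofrac p5 * tofrac p6 :> {fraction CR}).
Proof.
move=> H; rewrite -!rmorphM -rmorphD; congr (tofrac _).
apply/eqP; rewrite -subr_eq0; apply/eqP/coordinate_ring_eq0 => A.
by rewrite rmorphB rmorphD !rmorphM /= H subrr.
Qed.

Definition three_term_holds (e a b c d : 'I_n) :=
  plucker3 a c e * plucker3 b d e =
  plucker3 a b e * plucker3 c d e + plucker3 a d e * plucker3 b c e.

Lemma plucker3C x y z : plucker3 x y z = plucker3 y x z.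
Proof. by rewrite /plucker3 (finset.setUC [set x]%SET). Qed.

Lemma plucker3CA x y z : plucker3 x y z = plucker3 x z y.
Proof. by rewrite /plucker3 finset.setUAC. Qed.

(** Moving e to the last place in a triple (x, y, e) costs a sign if e lies between x
and y. The product of the two signs is the same in all three terms, wherever e
lies among a < b < c < d, and then the relation is an identity of determinants. *)
Lemma three_term_increasing (e a b c d : 'I_n) :
  (a < b)%N -> (b < c)%N -> (c < d)%N -> e \notin [:: a; b; c; d] -> three_term_holds e a b c d.
Proof.
move=> ab bc cd; rewrite !inE !negb_or -!val_eqE /= => /and4P[ea eb ec ed].
have ac := ltn_trans ab bc; have bd := ltn_trans bc cd; have ad := ltn_trans ab bd.
rewrite /three_term_holds.
have B (x y : 'I_n) : (x < y)%N -> e != x :> nat -> e != y :> nat ->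
    exists2 p : CR, plucker3 x y e = tofrac p &
    forall A, eval_at A p = (-1) ^+ (x < e < y)%N * bracket A x y e.
  move=> xy ex ey; case: (ltngtP e x) ex => // [lt|gt] _.
    have [p pE HA] := plucker3_bracket lt xy; exists p => [|A].
      by rewrite -pE plucker3CA plucker3C.
    by rewrite HA /bracket /=; ring.
  case: (ltngtP e y) ey => // [lt|gt'] _.
    have [p pE HA] := plucker3_bracket gt lt; exists p => [|A].
      by rewrite -pE plucker3CA.
    by rewrite HA /bracket /=; ring.
  have [p pE HA] := plucker3_bracket xy gt'; exists p => // A.
  by rewrite HA /bracket /=; ring.
have [p1 -> E1] := B _ _ ac ea ec; have [p2 -> E2] := B _ _ bd eb ed.
have [p3 -> E3] := B _ _ ab ea eb; have [p4 -> E4] := B _ _ cd ec ed.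
have [p5 -> E5] := B _ _ ad ea ed; have [p6 -> E6] := B _ _ bc eb ec.
apply: three_term_frac => A; rewrite E1 E2 E3 E4 E5 E6.
have key : bracket A a c e * bracket A b d e =
    bracket A a b e * bracket A c d e + bracket A a d e * bracket A b c e.
  by rewrite /bracket /=; ring.
have sgn (s1 s2 s3 s4 s5 s6 : bool) : s1 (+) s2 = s3 (+) s4 -> s1 (+) s2 = s5 (+) s6 ->
    (-1) ^+ s1 * bracket A a c e * ((-1) ^+ s2 * bracket A b d e) =
    (-1) ^+ s3 * bracket A a b e * ((-1) ^+ s4 * bracket A c d e) +
    (-1) ^+ s5 * bracket A a d e * ((-1) ^+ s6 * bracket A b c e).
  have M (s t : bool) (x y : C) : (-1) ^+ s * x * ((-1) ^+ t * y) = (-1) ^+ (s (+) t) * (x * y).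
    by rewrite mulrACA signr_addb.
  by rewrite !M => <- <-; rewrite key mulrDr.
have below (x : 'I_n) : e != x :> nat -> (e < x)%N = ~~ (x < e)%N.
  by move=> ex; rewrite -leqNgt ltn_neqAle ex.
have /implyP cd' : (d < e)%N -> (c < e)%N by apply: ltn_trans.
have /implyP bc' : (c < e)%N -> (b < e)%N by apply: ltn_trans.
have /implyP ab' : (b < e)%N -> (a < e)%N by apply: ltn_trans.
rewrite !below //; move: cd' bc' ab'.
by case: (a < e)%N; case: (b < e)%N; case: (c < e)%N; case: (d < e)%N => // _ _ _; apply: sgn.
Qed.

(** The relation only depends on the cyclic order of a, b, c, d, so it can be rotated
although rotation does not preserve the order of the columns. *)
Lemma three_term_rot (e a b c d : 'I_n) : three_term_holds e d a b c -> three_term_holds e a b c d.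
Proof.
rewrite /three_term_holds (plucker3C d b) (plucker3C d a) (plucker3C d c) => H.
by rewrite mulrC H addrC mulrC (mulrC (plucker3 a b e)).
Qed.

Definition plucker_nat (s : seq nat) : {fraction CR} :=
  plucker C 3 [set m : 'I_n | (m : nat) \in s]%SET.

Lemma plucker_nat_perm s t : perm_eq s t -> plucker_nat s = plucker_nat t.
Proof.
by move=> st; congr (plucker _ _ _); apply/setP => m; rewrite !inE (perm_mem st).
Qed.

Lemma plucker_nat3 (x y z : 'I_n) : plucker_nat [:: x : nat; y : nat; z : nat] = plucker3 x y z.
Proof. by congr (plucker _ _ _); apply/setP => m; rewrite !inE orbA. Qed.

Lemma plucker_nat_three_term q1 q2 u e a b c d : n = (q1 * q2)%N ->
  (a < b)%N -> (b < c)%N -> (c < d)%N -> (d < n)%N -> (e < n)%N ->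
  e \notin [:: a; b; c; d] ->
  let p x y z := plucker_nat (map (shift q1 q2 u) [:: x; y; z]) in
  p a c e * p b d e = p a b e * p c d e + p a d e * p b c e.
Proof.
move=> nE ab bc cd dn en ne /=.
have n0 : (0 < n)%N by apply: leq_ltn_trans dn.
pose t := (u %% n)%N; have tn : (t < n)%N by rewrite ltn_mod.
have sE x : (x < n)%N -> shift q1 q2 u x = (if x + t < n then x + t else x + t - n)%N.
  move=> xn; rewrite /shift -nE -modnDmr -/t; case: ltnP => lt; first by rewrite modn_small.
  by rewrite -{1}(subnK lt) modnDr modn_small //; lia.
have sn x : (x < n)%N -> (shift q1 q2 u x < n)%N by move=> xn; rewrite /shift -nE ltn_mod.
have [an bn cn] : [/\ (a < n)%N, (b < n)%N & (c < n)%N] by split; lia.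
have [sa sb sc sd] := And4 (sE a an) (sE b bn) (sE c cn) (sE d dn). 
have se := sE e en.
pose a' := Ordinal (sn a an); pose b' := Ordinal (sn b bn); pose c' := Ordinal (sn c cn).
pose d' := Ordinal (sn d dn); pose e' := Ordinal (sn e en).
suff : three_term_holds e' a' b' c' d' by rewrite /three_term_holds -!plucker_nat3.
have ne' : e' \notin [:: a'; b'; c'; d'].
  have inj x : (x < n)%N -> (shift q1 q2 u e == shift q1 q2 u x) = (e == x).
    by move=> xn; rewrite /shift -nE eqn_modDr !modn_small.
  by move: ne; rewrite !inE -!val_eqE /= !inj.
have incr x y z w : all (fun v => v \in [:: a'; b'; c'; d']) [:: x; y; z; w] ->
    [&& x < y, y < z & z < w]%N -> three_term_holds e' x y z w.
  move=> /allP sub /and3P[xy yz zw]; apply: three_term_increasing => //.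
  by apply: contra ne' => /sub.
case: (ltnP (d + t) n) => hd; [|case: (ltnP (c + t) n) => hc; [apply: three_term_rot
  |case: (ltnP (b + t) n) => hb; [do 2 apply: three_term_rot
  |case: (ltnP (a + t) n) => ha; [do 3 apply: three_term_rot|]]]];
  apply: incr; rewrite /= ?inE ?eqxx ?orbT // sa sb sc sd.
- by do ?(rewrite ifT; last by lia); lia.
- by rewrite ifF; [do ?(rewrite ifT; last by lia)|]; lia.
- rewrite 2?ifF; [do ?(rewrite ifT; last by lia)|..]; lia.
- rewrite 3?ifF; [do ?(rewrite ifT; last by lia)|..]; lia.
- rewrite !ifF; lia.
Qed.
End ThreeTerm.

(** * From a certificate to finite type *)

Section Initial.
Variables (n q : nat) (triples : seq (nat * nat * nat)).
Local Notation nn := (n * q)%N.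

Definition Iset_list i j : seq nat :=
  [seq m <- iota 0 nn | in_window 3 i j (offset 3 nn i j m)].

Definition interval_list s : seq nat := [seq m <- iota 0 nn | ((m + (nn - s)) %% nn < 3)%N].

(** The first q orbits are those of the q first cyclic intervals. *)
Definition interval_name (s : nat) : name := (s %% q, s %/ q)%N.

Definition initial_name (y : nat * nat) : name := plucker_name n q triples (Iset_list y.1.+1 y.2.+1).

Definition mutable_labels : seq (nat * nat) := [seq (i, j) | i <- iota 0 2, j <- iota 0 (nn - 3).-1].

Definition row_names : seq (seq nat * name) :=
  [seq (Iset_list y.1.+1 y.2.+1, initial_name y) | y <- mutable_labels]
  ++ [seq (interval_list s, interval_name s) | s <- iota 0 nn].

(** The initial exchange matrix, with subsets replaced by increasing lists. *)
Definition initial_entry (L : seq nat) (y : nat * nat) : int :=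
  let i := y.1.+1 in let j := y.2.+1 in
  let s : int := if odd (i + j) then -1 else 1 in
  if L \in [:: Iset_list i.-1 j; Iset_list i.+1 j] then s
  else if L \in [:: Iset_list i j.-1; Iset_list i j.+1] then - s else 0.

Definition initial_check (B : seq (seq (seq bool))) (T : seq (seq (seq (exrel name)))) : bool :=
  let rows := row_names in let names := map snd rows in
  [&& all (fun s => perm_eq (triple_of n q triples (interval_name s)) (interval_list s)) (iota 0 nn),
   all (fun y => names_triple n q triples (Iset_list y.1.+1 y.2.+1)) mutable_labels,
   all (fun y => all (fun y' => (y == y') ||
      compatible n B (initial_name y) (initial_name y')) mutable_labels) mutable_labels,
   all (fun y => all (fun y' => initial_entry (Iset_list y.1.+1 y.2.+1) y' ==
      - initial_entry (Iset_list y'.1.+1 y'.2.+1) y) mutable_labels) mutable_labels &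
   all (fun y => has (fun r =>
      all (fun row => initial_entry row.1 y ==
         (count_mem row.2 (pos r))%:Z - (count_mem row.2 (neg r))%:Z) rows
      && all (mem names) (pos r ++ neg r)) (lookup T (initial_name y))) mutable_labels].

End Initial.

(** Everything that remains to be computed: the derivation succeeds, the resulting
table is closed under pentagons, and the initial seed is represented in it. *)
Definition certificate n q triples steps : bool :=
  let N := (size triples + size (definitions steps))%N in
  if run n q triples N [::] steps is Some reps then
    let T0 := base_table n N reps in
    let B := cooccurrences n q N T0 in
    let T := full_table n T0 in
    [&& (0 < n)%N, (0 < q)%N, (5 < n * q)%N, (q <= size triples)%N,
        all (fun t => let: (a, b, c) := t in
          [&& a < b, b < c & c < n * q]%N) triples,
        definitions_ok (size triples) (definitions steps),
        all (fun r => (old r).1 < N)%N (variant_reps reps),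
        size B == N,
        initial_check n q triples B T &
        closed_check n q N B T]
  else false.

Section Certified.
Variables (C : numFieldType) (n q : nat) (triples : seq (nat * nat * nat)) (steps : seq step).
Hypothesis cert : certificate n q triples steps.
Local Notation nn := (n * q)%N.
Local Notation frac := {fraction coordinate_ring C 3 nn}.

Let P (x : frac) := positive_at (eval_at (vandermonde C 3 nn)) x.

Lemma plucker_nat_positive s : uniq s -> size s = 3 -> all (fun x => x < nn)%N s ->
  P (plucker_nat C nn s).
Proof.
move=> us ss sn; pose K := [set m : 'I_nn | (m : nat) \in s]%SET.
have cK : #|K| == 3.
  rewrite cardE -(size_map val) -ss; apply/eqP/perm_size/uniq_perm => //.
    by rewrite map_inj_uniq ?enum_uniq //; apply: val_inj.
  move=> x; apply/mapP/idP => [[m]|xs]; first by rewrite mem_enum inE => ? ->.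
  by exists (Ordinal (allP sn x xs)); rewrite // mem_enum inE.
exists (kminor (vandermonde C 3 nn) (Sub K cK : ksubset 3 nn)); last exact: has_value_plucker.
exact: lt_le_trans (kminor_vandermonde_ge1 _ _).
Qed.

Definition set_list (K : {set 'I_nn}) : seq nat := map val (enum K).

Lemma set_list_inj : injective set_list.
Proof.
move=> K L KL; apply/setP => m.
have E (S : {set 'I_nn}) : (m \in S) = (val m \in set_list S).
  by rewrite (mem_map val_inj) mem_enum.
by rewrite !E KL.
Qed.

Lemma set_list_filter (K : {set 'I_nn}) (p : pred nat) :
  (forall m : 'I_nn, (m \in K) = p m) -> set_list K = [seq m <- iota 0 nn | p m].
Proof.
move=> Kp; rewrite /set_list -val_enum_ord filter_map; congr (map val _).
by rewrite {1}/enum_mem -enumT; apply: eq_filter => m; exact: Kp.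
Qed.

Lemma set_list_Iset i j : (i <= 3)%N -> (3 + j <= nn)%N ->
  set_list (Iset 3 nn i j) = Iset_list n q i j.
Proof. by move=> i3 jn; apply: set_list_filter => m; rewrite mem_Iset. Qed.

Lemma set_list_interval (s : 'I_nn) : (3 <= nn)%N ->
  set_list (cyclic_interval nn (s.+1)%:Z 3) = interval_list n q s.
Proof.
move=> n3; apply: (set_list_filter (p := fun m => (m + (nn - s)) %% nn < 3)%N) => m.
by rewrite (@mem_cyclic_interval _ _ (-1) _ _ (m + (nn - s))) //; have := ltn_ord s; lia.
Qed.

Lemma plucker_set_list K : plucker C 3 K = plucker_nat C nn (set_list K).
Proof.
congr (plucker _ _ _); apply/setP => m; rewrite inE /set_list (mem_map val_inj).
by rewrite mem_enum.
Qed.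

(** Names outside the orbits of Plücker coordinates are given positive values by
their defining relations, so that all names denote nonzero elements; the derived
relations then hold, and the closure criterion applies to the initial seed. *)
Theorem certificate_finite : finite_type (gr_seed C 3 nn).
Proof.
move: cert; rewrite /certificate; set N := (_ + _)%N.
case E: run => [reps|//]; set T0 := base_table _ _ _; set B := cooccurrences _ _ _ _.
set T := full_table _ _.
case/and5P => n0 q0 n5 qt /and5P[tr dok ro /eqP Bs /andP[ini clo]].
have X0P v : (v.1 < size triples)%N -> P (plucker_nat C nn (triple_of n q triples v)).
  move=> vt; have := allP tr _ (mem_nth (0, 0, 0)%N vt); rewrite /triple_of.
  case: (nth _ _ _) => [[a b] c] /and3P[ab bc cn].
  have nn0 : (0 < nn)%N by lia.
  apply: plucker_nat_positive => //; last by rewrite /= /shift !ltn_mod nn0.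
  rewrite map_inj_in_uniq.
    by rewrite /= !inE negb_or; lia.
  move=> x y; rewrite !inE => xs ys /eqP; rewrite /shift eqn_modDr !modn_small; first by move/eqP.
    by move: ys => /or3P[] /eqP ->; lia.
  by move: xs => /or3P[] /eqP ->; lia.
have P1 : P 1 by exists 1; [exact: ltr01|exact: has_value1].
have [X [XX0 XP Xdef]] := @define_names n _ P P1 (@positive_atD _ _ _) (@positive_atM _ _ _)
  (@positive_atV _ _ _) (@positive_at_neq0 _ _ _) _ _ _ dok X0P.
have Xneq0 v : (v.1 < N)%N -> X v != 0 by move=> /XP /positive_at_neq0.
have hold : {in reps, forall r, holds_all n X r}.
  apply: (@run_holds n q triples N _ (plucker_nat C nn) X (@plucker_nat_perm C nn)) E => //.
  by move=> u e a b c d *; apply: plucker_nat_three_term.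
have Eold r : in_table n reps r -> ((old r).1 < N)%N by apply: in_table_old.
pose b (y : gr_mutable 3 nn) := initial_name n q triples (val y.1, val y.2).
pose fz (j : 'I_nn) := interval_name q j.
have fz_inj : injective fz.
  by move=> i j [m d]; apply: val_inj; rewrite /= (divn_eq i q) (divn_eq j q) m d.
have wf := @table_well_formed n n0 q N reps B T erefl clo ro.
have Bs' : (size B <= N)%N by rewrite Bs.
have initial_represented : represented X (in_table n reps) (compatible n B) fz (gr_seed C 3 nn) b.
  case/and5P: ini => /allP ivl /allP nmt /allP cmp /allP skw /allP col.
  have lab (y : gr_mutable 3 nn) : (val y.1, val y.2) \in mutable_labels n q.
    case: y => [[i i2] [j jn]] /=; apply/allpairsP; exists (i, j).
    by rewrite !mem_iota /= i2 jn.
  have Xname s : names_triple n q triples s -> X (plucker_name n q triples s) = plucker_nat C nn s.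
    by move=> /and3P[lt _ pt]; rewrite XX0 //; apply: plucker_nat_perm.
  pose row (r : gr_mutable 3 nn + 'I_nn) :=
    match r with inl y => Iset_list n q y.1.+1 y.2.+1 | inr s => interval_list n q s end.
  have rowE r : set_list (gr_subset r) = row r.
    case: r => [[[i i2] [j jn]]|s] /=; last by apply: set_list_interval; lia.
    by rewrite set_list_Iset //; lia.
  have entryE r y : exchange (gr_seed C 3 nn) r y = initial_entry n q (row r) (val y.1, val y.2).
    case: y => [[i i2] [j jn]]; rewrite /= /gr_exchange /initial_entry -signr_odd /=.
    rewrite -!(mem_map set_list_inj) /= rowE !set_list_Iset; try lia.
    by case: (odd _).
  split.
  - move=> y; rewrite /= plucker_set_list.
    have -> := rowE (inl y); rewrite /b /initial_name Xname //.
    exact: (nmt _ (lab y)).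
  - move=> s; rewrite /= plucker_set_list set_list_interval; last by lia.
    rewrite XX0; last by rewrite /= (leq_trans _ qt) // ltn_mod.
    by apply/esym/plucker_nat_perm/ivl; rewrite mem_iota ltn_ord.
  - move=> i j ij; have /allP/(_ _ (lab j)) := cmp _ (lab i).
    case/orP => // /eqP[e1 e2]; case/eqP: ij.
    by case: i j e1 e2 => [i1 i2] [j1 j2] /= /val_inj -> /val_inj ->.
  - move=> i j; rewrite !entryE /=.
    by have /allP/(_ _ (lab j))/eqP := skw _ (lab i).
  - move=> y; have /hasP[r rT /andP[/allP rc /allP rs]] := col _ (lab y).
    have /and3P[n1 n2 _] := nmt _ (lab y).
    have rowsE r' : (row r', name_of fz b r') \in row_names n q triples.
      rewrite mem_cat; case: r' => [x|s] /=; apply/orP; [left|right].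
        by apply/mapP; exists (val x.1, val x.2).
      by apply/mapP; exists (val s); rewrite // mem_iota ltn_ord.
    have n1' : ((b y).1 < N)%N by apply: leq_trans n1 (leq_addr _ _).
    have [|Er ro'] := @lookupP n n0 q N reps B T erefl clo r _ _ n1' n2.
      by rewrite -surjective_pairing.
    exists r; split=> //.
    + by rewrite ro' -surjective_pairing.
    + by move=> r'; rewrite entryE (eqP (rc _ (rowsE r'))).
    + move=> v /rs /mapP[[L w] + /= ->]; rewrite mem_cat => /orP[]/mapP.
        move=> [_ /allpairsP[[i j] [+ + ->]] [_ ->]]; rewrite !mem_iota => i2 jn.
        by apply/codomP; exists (inl (Ordinal (i2 : (i < 3.-1)%N), Ordinal jn)).
      move=> [s]; rewrite mem_iota => sn [_ ->].
      by apply/codomP; exists (inr (Ordinal (sn : (s < nn)%N))).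
apply: (@represented_finite _ _ _ _ X (in_table n reps) (compatible n B) (frozen q) fz fz_inj
  _ _ _ _ _ _ wf _ _ (gr_seed C 3 nn) b [seq (i, m) | i <- iota 0 N, m <- iota 0 n]).
- by move=> j; rewrite /frozen /= ltn_mod.
- by move=> v; rewrite /compatible eqxx.
- exact: in_table_swap.
- exact: in_table_flip.
- move=> r [r0 /flattenP[l /mapP[r1 /hold H ->]] r0v [s ->]].
  apply/holds_map.
  have [k ->] : exists k, r0 = variant k r1.
    by move: r0v; rewrite !inE => /or4P[] /eqP ->; [exists 0%N|exists 1%N|exists 2%N|exists 3%N].
  exact: holds_all_variant.
- by move=> r /Eold /Xneq0.
- exact: (@table_link n n0 q N reps B T erefl clo Bs' ro).
- exact: (@table_pentagon n n0 q N reps B T erefl clo ro).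
- exact: initial_represented.
- move=> r Er; have [on _ _ _] := in_table_normal n0 Er; apply/allpairsP; exists (old r).
  by rewrite !mem_iota Eold // ; split => //; case: (old r).
Qed.
End Certified.

Local Close Scope ring_scope.

(** * The tables for n = 6, 7, 8 *)

(** Six columns are rotated by three steps at a time; for seven and eight columns
there is a single frozen orbit. The derivations were found by saturating the
Plücker relations under the pentagon identity, introducing an orbit of variables
of degree 2 or 3 when nothing new was found. *)
Definition triples_6 : seq (nat * nat * nat) :=
  [:: (0,1,2); (1,2,3); (2,3,4); (0,1,3); (0,1,4); (0,2,3); (0,2,4); (0,2,5);
  (1,2,4); (1,2,5)].

Definition derivation_6 : seq step := [::
  Plucker 5 0 2 3 4; Plucker 4 0 2 3 5; Plucker 4 1 2 3 5; Plucker 5 1 2 3 4;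
  Plucker 5 0 1 2 4; Plucker 0 1 2 4 5; Plucker 0 1 2 3 5; Plucker 5 0 1 2 3;
  Plucker 0 1 3 4 5; Plucker 5 0 1 3 4; Plucker 0 2 3 4 5; Plucker 4 0 1 2 5;
  Plucker 4 0 1 3 5; Plucker 0 1 2 3 4; Plucker 4 0 1 2 3;
  Define (7,0) (10,0) [:: (9,1); (2,1); (5,0)] [:: (1,1); (7,1); (0,0)];
  Pentagon (15,1,1) (0,0,2) (4,1,2); Pentagon (6,0,0) (0,0,0) (15,0,0);
  Pentagon (4,1,3) (0,0,3) (15,1,0); Pentagon (15,0,1) (0,0,1) (6,0,1);
  Pentagon (15,1,3) (7,0,0) (5,1,3); Pentagon (5,1,2) (7,0,1) (15,1,2);
  Pentagon (13,0,0) (1,0,0) (21,1,1); Pentagon (1,1,0) (3,0,0) (18,1,3);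
  Pentagon (2,0,2) (4,0,1) (18,0,1); Pentagon (12,1,0) (2,0,0) (24,1,1)].

Definition triples_7 : seq (nat * nat * nat) :=
  [:: (0,1,2); (0,1,3); (0,1,4); (0,1,5); (0,2,4)].

Definition derivation_7 : seq step := [::
  Plucker 6 0 3 4 5; Plucker 5 0 3 4 6; Plucker 5 1 3 4 6; Plucker 6 2 3 4 5;
  Plucker 6 1 3 4 5; Plucker 6 0 2 3 5; Plucker 0 2 3 5 6; Plucker 6 0 1 3 5;
  Plucker 6 0 1 3 4; Plucker 0 2 3 4 6; Plucker 6 0 2 3 4; Plucker 0 1 2 3 6;
  Plucker 6 0 1 2 3; Plucker 6 0 1 2 4; Plucker 3 0 1 5 6;
  Define (2,2) (5,0) [:: (2,6); (0,2); (3,1)] [:: (1,3); (1,6); (0,1)];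
  Pentagon (5,1,0) (0,0,0) (15,4,0); Pentagon (15,4,1) (0,0,1) (5,1,1);
  Pentagon (15,0,1) (10,0,2) (7,3,2); Pentagon (7,3,3) (10,0,3) (15,0,0);
  Pentagon (15,0,3) (12,0,0) (2,5,0); Pentagon (2,5,1) (12,0,1) (15,0,2);
  Pentagon (10,1,0) (1,0,0) (21,4,1); Pentagon (6,1,3) (4,0,0) (19,4,3);
  Pentagon (13,2,0) (8,0,3) (21,0,1); Pentagon (19,1,0) (1,0,0) (24,6,3);
  Pentagon (24,6,2) (1,0,1) (19,1,1); Pentagon (9,1,3) (2,0,0) (24,4,3);
  Pentagon (23,4,0) (2,0,0) (19,6,3); Pentagon (21,0,0) (7,0,2) (24,2,1);
  Pentagon (25,6,0) (15,0,3) (22,6,3);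
  Define (1,1) (6,0) [:: (0,1); (5,5)] [:: (2,1); (5,0)];
  Pentagon (31,6,3) (17,0,2) (18,6,2); Pentagon (18,6,3) (17,0,3) (31,6,2);
  Pentagon (31,1,3) (26,0,2) (11,3,3); Pentagon (11,3,2) (26,0,3) (31,1,2);
  Pentagon (31,2,3) (29,0,2) (12,4,0); Pentagon (12,4,1) (29,0,3) (31,2,2);
  Pentagon (31,5,1) (30,0,2) (20,0,1); Pentagon (20,0,0) (30,0,3) (31,5,0);
  Pentagon (37,6,0) (3,0,2) (18,6,3); Pentagon (37,4,0) (16,0,2) (6,4,1);
  Pentagon (6,4,0) (16,0,3) (37,4,1); Pentagon (29,5,3) (18,0,0) (39,0,1);
  Pentagon (2,6,3) (22,0,3) (37,4,1); Pentagon (4,5,0) (23,0,3) (35,5,1);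
  Pentagon (0,5,0) (27,0,3) (35,5,1); Pentagon (17,2,0) (28,0,2) (35,2,3);
  Pentagon (3,2,0) (28,0,3) (33,2,1); Pentagon (36,4,0) (33,0,2) (39,6,3);
  Pentagon (39,6,2) (33,0,3) (36,4,1); Pentagon (6,3,1) (2,0,1) (45,4,1);
  Pentagon (5,4,2) (5,0,2) (46,5,1); Pentagon (2,0,2) (7,0,1) (42,6,1);
  Pentagon (7,5,2) (8,0,1) (44,6,1)].

Definition triples_8 : seq (nat * nat * nat) :=
  [:: (0,1,2); (0,1,3); (0,1,4); (0,1,5); (0,1,6); (0,2,4); (0,2,5)].

Definition derivation_8 : seq step := [::
  Plucker 7 0 4 5 6; Plucker 6 0 4 5 7; Plucker 6 1 4 5 7; Plucker 7 3 4 5 6;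
  Plucker 6 2 4 5 7; Plucker 7 1 4 5 6; Plucker 7 2 4 5 6; Plucker 7 0 3 4 6;
  Plucker 0 3 4 6 7; Plucker 0 2 4 6 7; Plucker 7 0 2 4 6; Plucker 7 0 1 4 6;
  Plucker 0 2 4 5 7; Plucker 0 3 4 5 7; Plucker 7 0 1 4 5; Plucker 7 0 2 4 5;
  Plucker 7 0 3 4 5; Plucker 0 1 3 4 7; Plucker 7 0 1 3 4; Plucker 0 2 3 4 7;
  Plucker 7 0 2 3 4; Plucker 0 2 3 6 7; Plucker 0 2 3 5 7; Plucker 7 0 1 3 6;
  Plucker 7 0 1 3 5; Plucker 7 0 2 3 5; Plucker 0 1 2 3 7; Plucker 0 1 2 3 6;
  Plucker 0 1 2 3 5; Plucker 0 1 2 3 4; Plucker 3 0 1 6 7; Plucker 3 0 1 5 7;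
  Plucker 7 1 2 3 4; Plucker 7 1 2 3 5; Plucker 7 1 2 4 5;
  Define (1,0) (7,0) [:: (2,7); (0,0); (4,3)] [:: (0,7); (3,3); (0,1)];
  Pentagon (35,4,1) (0,0,2) (26,4,2); Pentagon (26,4,3) (0,0,3) (35,4,0);
  Pentagon (35,4,3) (16,0,0) (1,7,0); Pentagon (1,7,1) (16,0,1) (35,4,2);
  Pentagon (26,1,0) (17,0,0) (35,0,0); Pentagon (35,0,1) (17,0,1) (26,1,1);
  Pentagon (23,4,3) (3,0,0) (40,3,3); Pentagon (29,2,0) (4,0,0) (39,7,1);
  Pentagon (2,7,1) (13,0,2) (40,4,1); Pentagon (28,2,0) (6,0,0) (44,7,1);
  Define (2,0) (8,0) [:: (3,7); (7,1)] [:: (2,4); (0,7); (0,2)];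
  Pentagon (41,0,2) (7,0,0) (46,7,0); Pentagon (46,7,1) (7,0,1) (41,0,3);
  Pentagon (46,3,1) (39,0,0) (23,4,2); Pentagon (23,4,3) (39,0,1) (46,3,0);
  Pentagon (46,2,1) (43,0,2) (17,2,2); Pentagon (17,2,3) (43,0,3) (46,2,0);
  Pentagon (50,7,2) (4,0,1) (19,2,2); Pentagon (27,2,0) (12,0,0) (50,5,3);
  Pentagon (11,4,3) (13,0,0) (52,6,3); Pentagon (52,2,0) (17,0,0) (7,0,0);
  Pentagon (7,0,1) (17,0,1) (52,2,1); Pentagon (14,6,2) (25,0,1) (50,0,1);
  Pentagon (47,0,2) (40,0,2) (52,2,1); Pentagon (52,2,0) (40,0,3) (47,0,3);
  Pentagon (54,4,2) (2,0,1) (55,1,1); Pentagon (57,4,0) (7,0,2) (40,3,1);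
  Pentagon (40,3,0) (7,0,3) (57,4,1); Pentagon (44,7,2) (10,0,3) (58,5,1);
  Pentagon (28,2,0) (15,0,3) (58,5,1); Pentagon (23,4,3) (16,0,3) (57,4,1);
  Pentagon (56,7,2) (26,0,1) (60,7,1); Pentagon (60,4,0) (54,0,0) (10,6,3);
  Pentagon (48,1,2) (0,0,0) (62,0,1); Pentagon (63,1,0) (37,0,0) (52,2,3);
  Pentagon (43,2,0) (46,0,0) (62,0,1); Pentagon (62,0,0) (46,0,1) (43,2,1);
  Pentagon (60,3,0) (47,0,0) (64,5,3); Pentagon (51,6,1) (63,0,0) (40,7,3);
  Pentagon (40,7,2) (63,0,1) (51,6,0);
  Define (1,7) (9,0) [:: (0,7); (8,0)] [:: (2,7); (8,5)];
  Pentagon (76,2,3) (53,0,2) (48,0,2); Pentagon (48,0,3) (53,0,3) (76,2,2);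
  Pentagon (76,4,3) (61,0,2) (26,4,3); Pentagon (26,4,2) (61,0,3) (76,4,2);
  Pentagon (29,2,1) (68,0,2) (76,3,2); Pentagon (76,3,3) (68,0,3) (29,2,0);
  Pentagon (76,4,1) (70,0,2) (36,0,0); Pentagon (36,0,1) (70,0,3) (76,4,0);
  Pentagon (81,1,0) (3,0,2) (56,0,2); Pentagon (62,5,3) (41,0,0) (84,4,1);
  Pentagon (38,7,1) (51,0,3) (80,6,3); Pentagon (0,6,0) (52,0,3) (80,6,1);
  Pentagon (80,4,0) (55,0,2) (5,4,1); Pentagon (5,4,0) (55,0,3) (80,4,1);
  Pentagon (4,1,3) (57,0,1) (81,1,1); Pentagon (3,5,0) (60,0,3) (78,5,1);
  Pentagon (9,3,0) (66,0,3) (81,5,1); Pentagon (8,4,1) (10,0,2) (90,7,1);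
  Pentagon (88,6,2) (13,0,1) (14,4,2); Pentagon (7,5,2) (17,0,2) (88,6,1);
  Pentagon (10,5,2) (18,0,1) (91,4,1); Pentagon (9,5,1) (24,0,1) (93,0,1);
  Define (4,2) (10,0) [:: (3,2); (7,1)] [:: (0,1); (8,0)];
  Pentagon (0,6,3) (49,0,2) (99,3,0); Pentagon (99,3,1) (49,0,3) (0,6,2);
  Pentagon (3,6,0) (51,0,2) (99,2,0); Pentagon (99,2,1) (51,0,3) (3,6,1);
  Pentagon (99,4,1) (56,0,2) (38,1,2); Pentagon (38,1,3) (56,0,3) (99,4,0);
  Pentagon (78,3,0) (73,0,2) (99,7,2); Pentagon (99,7,3) (73,0,3) (78,3,1);
  Pentagon (36,3,0) (74,0,2) (99,0,2); Pentagon (99,0,3) (74,0,3) (36,3,1);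
  Pentagon (102,7,0) (29,0,3) (53,7,2); Pentagon (20,5,1) (46,0,2) (105,4,1);
  Pentagon (105,4,0) (46,0,3) (20,5,0); Pentagon (105,3,0) (47,0,0) (19,4,3);
  Pentagon (19,4,2) (47,0,1) (105,3,1); Pentagon (18,4,1) (57,0,3) (102,2,1);
  Pentagon (28,2,1) (58,0,3) (100,0,1); Pentagon (53,2,1) (59,0,2) (105,3,3);
  Pentagon (92,0,2) (61,0,3) (102,7,1); Pentagon (83,4,2) (62,0,1) (106,3,1);
  Pentagon (23,0,1) (63,0,1) (102,6,1); Pentagon (26,7,1) (64,0,1) (100,5,1);
  Pentagon (27,7,1) (65,0,1) (100,5,1); Pentagon (24,0,1) (66,0,1) (102,6,1);
  Pentagon (109,1,2) (70,0,1) (107,2,1); Pentagon (41,5,0) (72,0,0) (105,4,1);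
  Pentagon (77,1,0) (81,0,2) (102,1,3); Pentagon (106,6,0) (81,0,0) (63,3,2);
  Pentagon (82,2,0) (107,0,0) (67,4,2); Pentagon (10,0,0) (4,0,3) (115,7,1);
  Pentagon (111,7,0) (8,0,2) (41,0,3); Pentagon (123,1,0) (9,0,2) (42,1,1);
  Pentagon (9,2,3) (9,0,0) (123,5,1); Pentagon (12,2,3) (10,0,3) (122,5,1);
  Pentagon (15,2,0) (11,0,3) (116,2,1); Pentagon (115,5,0) (12,0,2) (40,4,1);
  Pentagon (56,3,0) (47,0,0) (121,5,1); Pentagon (128,0,2) (106,0,0) (126,2,1);
  Define (1,7) (11,0) [:: (0,7); (9,3)] [:: (2,7); (10,5)];
  Pentagon (138,1,3) (85,0,2) (130,7,2); Pentagon (130,7,3) (85,0,3) (138,1,2);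
  Pentagon (138,2,1) (107,0,2) (76,2,2); Pentagon (76,2,3) (107,0,3) (138,2,0);
  Pentagon (138,4,3) (118,0,2) (26,4,3); Pentagon (26,4,2) (118,0,3) (138,4,2);
  Pentagon (138,5,3) (119,0,0) (29,4,0); Pentagon (29,4,1) (119,0,1) (138,5,2);
  Pentagon (138,4,1) (124,0,0) (36,0,0); Pentagon (36,0,1) (124,0,1) (138,4,0);
  Pentagon (146,7,0) (3,0,2) (95,7,3); Pentagon (135,4,3) (41,0,0) (148,4,1);
  Pentagon (147,5,2) (79,0,0) (141,7,1); Pentagon (142,6,0) (86,0,2) (112,5,3);
  Pentagon (81,2,2) (86,0,1) (146,0,1); Pentagon (146,2,0) (88,0,2) (8,2,1);
  Pentagon (8,2,0) (88,0,3) (146,2,1); Pentagon (6,1,0) (90,0,3) (144,1,1);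
  Pentagon (80,0,2) (92,0,3) (144,0,1); Pentagon (0,0,0) (94,0,1) (144,0,1);
  Pentagon (4,2,3) (96,0,1) (146,0,1); Pentagon (30,3,0) (127,0,2) (140,7,1);
  Pentagon (34,5,1) (2,0,1) (156,1,1); Pentagon (159,3,2) (7,0,2) (25,4,2);
  Pentagon (12,4,2) (17,0,2) (158,4,1); Pentagon (22,4,2) (18,0,1) (159,3,1);
  Pentagon (15,7,1) (23,0,1) (155,1,1); Pentagon (130,3,1) (119,0,0) (153,3,3);
  Pentagon (139,4,0) (146,0,2) (157,4,3);
  Define (3,2) (12,0) [:: (2,2); (8,0)] [:: (4,2); (7,3)];
  Pentagon (56,1,3) (41,0,2) (168,5,0); Pentagon (168,5,1) (41,0,3) (56,1,2);
  Pentagon (168,0,1) (63,0,2) (13,3,1); Pentagon (13,3,0) (63,0,3) (168,0,0);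
  Pentagon (168,0,1) (64,0,2) (16,3,2); Pentagon (16,3,3) (64,0,3) (168,0,0);
  Pentagon (48,5,0) (70,0,2) (168,1,2); Pentagon (168,1,3) (70,0,3) (48,5,1);
  Pentagon (38,3,0) (74,0,0) (168,0,0); Pentagon (168,0,1) (74,0,1) (38,3,1);
  Pentagon (95,4,0) (84,0,2) (168,1,2); Pentagon (168,1,3) (84,0,3) (95,4,1);
  Pentagon (172,1,0) (18,0,3) (38,0,3); Pentagon (14,4,1) (35,0,2) (172,5,1);
  Pentagon (176,0,2) (36,0,0) (180,0,1); Pentagon (11,0,1) (37,0,1) (172,1,1);
  Pentagon (174,5,0) (39,0,1) (71,3,3); Pentagon (24,0,1) (39,0,3) (174,1,1);
  Pentagon (23,7,1) (43,0,1) (174,0,1); Pentagon (172,5,0) (44,0,1) (75,5,1);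
  Pentagon (174,6,2) (46,0,2) (92,4,1); Pentagon (92,4,0) (46,0,3) (174,6,3);
  Pentagon (60,3,3) (53,0,1) (175,6,1); Pentagon (29,4,1) (62,0,3) (169,3,1);
  Pentagon (71,2,3) (71,0,0) (177,6,3); Pentagon (49,5,0) (72,0,3) (177,2,1);
  Pentagon (169,0,2) (73,0,2) (76,2,2); Pentagon (138,2,3) (106,0,2) (169,0,3);
  Pentagon (169,0,2) (106,0,3) (138,2,2);
  Pentagon (172,6,2) (111,0,3) (160,3,1); Pentagon (165,0,2) (2,0,3) (182,6,1);
  Pentagon (170,7,2) (4,0,3) (189,6,1); Pentagon (170,7,2) (6,0,3) (198,6,1);
  Pentagon (23,1,0) (10,0,0) (182,7,1); Pentagon (94,4,2) (17,0,3) (187,6,1);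
  Pentagon (161,4,2) (21,0,0) (184,4,1); Pentagon (2,4,0) (22,0,0) (184,4,1);
  Pentagon (98,2,2) (23,0,3) (186,4,1); Pentagon (24,2,0) (24,0,3) (186,4,1);
  Pentagon (10,3,3) (25,0,3) (187,5,1); Pentagon (189,3,2) (32,0,0) (198,3,1);
  Pentagon (4,2,3) (46,0,0) (192,0,1); Pentagon (0,0,0) (47,0,3) (191,0,3);
  Pentagon (178,7,2) (59,0,1) (195,2,1); Pentagon (195,5,2) (78,0,1) (197,5,1);
  Pentagon (178,2,2) (87,0,1) (197,5,1);
  Pentagon (128,5,3) (115,0,2) (182,0,1);
  Pentagon (147,4,1) (163,0,2) (184,5,1);
  Pentagon (173,5,0) (169,0,2) (194,5,3);
  Define (3,7) (13,0) [:: (2,7); (10,5)] [:: (0,6); (7,0)];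
  Pentagon (104,1,2) (41,0,2) (218,0,0); Pentagon (218,0,1) (41,0,3) (104,1,3);
  Pentagon (168,0,3) (99,0,0) (218,3,0); Pentagon (218,3,1) (99,0,1) (168,0,2);
  Pentagon (218,3,1) (108,0,0) (38,3,1); Pentagon (38,3,0) (108,0,1) (218,3,0);
  Pentagon (218,3,1) (120,0,0) (8,3,1); Pentagon (8,3,0) (120,0,1) (218,3,0);
  Pentagon (218,3,1) (121,0,0) (7,3,2); Pentagon (7,3,3) (121,0,1) (218,3,0);
  Pentagon (77,5,1) (124,0,0) (218,4,2); Pentagon (218,4,3) (124,0,1) (77,5,0);
  Pentagon (162,4,0) (148,0,2) (218,4,2);
  Pentagon (218,4,3) (148,0,3) (162,4,1); Pentagon (226,1,0) (20,0,3) (38,0,3);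
  Pentagon (226,2,2) (28,0,2) (172,2,1); Pentagon (172,2,0) (28,0,3) (226,2,3);
  Pentagon (174,2,0) (29,0,3) (228,2,3); Pentagon (15,4,1) (35,0,2) (226,5,1);
  Pentagon (230,0,2) (36,0,0) (232,0,1); Pentagon (10,0,1) (37,0,1) (226,1,1);
  Pentagon (25,0,1) (39,0,3) (228,1,1); Pentagon (17,6,1) (43,0,1) (228,0,1);
  Pentagon (228,4,0) (43,0,3) (71,2,3); Pentagon (226,4,0) (45,0,3) (75,4,1);
  Pentagon (56,4,0) (46,0,3) (228,6,3); Pentagon (75,4,1) (71,0,0) (224,6,3);
  Pentagon (51,6,0) (72,0,3) (224,2,1); Pentagon (127,1,2) (85,0,1) (229,5,1);
  Pentagon (169,7,0) (105,0,3) (219,7,3);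
  Pentagon (104,4,1) (111,0,2) (226,6,3);
  Pentagon (28,5,1) (135,0,3) (219,4,1);
  Pentagon (188,1,1) (193,0,2) (224,0,1);
  Pentagon (221,2,0) (194,0,2) (53,6,1);
  Pentagon (221,7,0) (217,0,2) (181,4,0); Pentagon (11,0,0) (2,0,3) (237,6,1);
  Pentagon (7,4,3) (17,0,3) (241,6,1); Pentagon (4,4,0) (21,0,0) (239,4,1);
  Pentagon (14,2,0) (23,0,3) (240,4,1); Pentagon (63,4,3) (56,0,0) (246,4,1);
  Pentagon (44,1,3) (71,0,1) (245,2,1); Pentagon (190,5,0) (86,0,2) (244,5,3);
  Pentagon (196,6,0) (150,0,2) (249,5,3);
  Define (2,7) (14,0) [:: (0,7); (0,3); (9,3)] [:: (8,0); (11,0)];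
  Pentagon (139,0,2) (79,0,2) (262,1,2); Pentagon (262,1,3) (79,0,3) (139,0,3);
  Pentagon (53,6,3) (138,0,2) (262,0,2); Pentagon (262,0,3) (138,0,3) (53,6,2);
  Pentagon (77,0,0) (141,0,2) (262,2,0); Pentagon (262,2,1) (141,0,3) (77,0,1);
  Pentagon (262,4,3) (144,0,2) (51,2,2); Pentagon (51,2,3) (144,0,3) (262,4,2);
  Pentagon (262,5,3) (146,0,2) (102,3,3);
  Pentagon (102,3,2) (146,0,3) (262,5,2);
  Pentagon (270,7,0) (49,0,3) (118,7,3); Pentagon (130,6,3) (82,0,2) (265,0,3);
  Pentagon (152,4,2) (83,0,0) (267,2,1); Pentagon (272,4,0) (84,0,2) (218,4,2);
  Pentagon (218,4,3) (84,0,3) (272,4,1); Pentagon (104,1,2) (86,0,1) (272,0,1);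
  Pentagon (38,1,3) (92,0,3) (270,0,1); Pentagon (270,1,2) (95,0,2) (99,5,0);
  Pentagon (272,6,0) (100,0,2) (119,6,1);
  Pentagon (48,0,1) (107,0,3) (265,2,1);
  Pentagon (162,2,0) (142,0,2) (272,2,3);
  Pentagon (237,2,2) (154,0,2) (263,6,1);
  Pentagon (221,1,0) (179,0,2) (270,5,1);
  Pentagon (181,5,1) (190,0,2) (270,4,3); Pentagon (18,5,1) (46,0,2) (279,4,1);
  Pentagon (278,3,2) (62,0,3) (219,3,1); Pentagon (112,3,2) (67,0,3) (282,4,1);
  Pentagon (232,7,2) (109,0,2) (277,7,1);
  Pentagon (28,4,1) (112,0,2) (278,3,1);
  Pentagon (240,7,2) (127,0,2) (274,0,1);
  Pentagon (243,2,2) (161,0,3) (284,7,1);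
  Define (3,7) (15,0) [:: (8,0); (11,0)] [:: (0,6); (0,2); (9,0)];
  Pentagon (162,4,2) (83,0,2) (294,4,0); Pentagon (294,4,1) (83,0,3) (162,4,3);
  Pentagon (294,2,3) (141,0,2) (77,3,0); Pentagon (77,3,1) (141,0,3) (294,2,2);
  Pentagon (294,5,1) (153,0,2) (62,5,3); Pentagon (62,5,2) (153,0,3) (294,5,0);
  Pentagon (294,4,1) (157,0,2) (192,4,3);
  Pentagon (192,4,2) (157,0,3) (294,4,0);
  Pentagon (294,7,1) (213,0,2) (48,0,3); Pentagon (48,0,2) (213,0,3) (294,7,0);
  Pentagon (288,2,0) (267,0,2) (294,2,2);
  Pentagon (294,2,3) (267,0,3) (288,2,1);
  Pentagon (300,3,0) (69,0,0) (206,6,3); Pentagon (297,0,2) (77,0,1) (306,0,1);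
  Pentagon (154,2,2) (79,0,0) (298,7,1); Pentagon (170,7,3) (80,0,3) (302,0,1);
  Pentagon (41,6,3) (81,0,3) (300,6,1); Pentagon (300,7,2) (85,0,3) (169,7,1);
  Pentagon (248,6,2) (87,0,3) (302,6,1); Pentagon (181,2,3) (89,0,2) (304,1,3);
  Pentagon (130,0,1) (106,0,2) (300,0,3);
  Pentagon (219,6,2) (126,0,2) (300,6,1);
  Pentagon (254,5,2) (152,0,2) (295,4,1);
  Pentagon (199,5,0) (167,0,3) (295,4,3);
  Pentagon (302,3,0) (191,0,0) (203,4,3);
  Pentagon (53,3,0) (195,0,3) (304,3,1); Pentagon (171,4,2) (61,0,1) (320,7,1);
  Pentagon (8,3,0) (63,0,3) (311,5,1); Pentagon (225,0,2) (109,0,0) (316,5,1);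
  Pentagon (261,4,2) (147,0,0) (318,7,1);
  Pentagon (198,4,3) (154,0,0) (318,2,1);
  Pentagon (256,6,2) (189,0,3) (314,3,1);
  Define (5,4) (16,0) [:: (4,6); (15,5)] [:: (0,4); (7,0); (0,6)];
  Pentagon (312,1,2) (1,0,0) (327,0,0); Pentagon (327,0,1) (1,0,1) (312,1,3);
  Pentagon (327,0,3) (299,0,2) (145,0,0);
  Pentagon (145,0,1) (299,0,3) (327,0,2);
  Pentagon (327,0,1) (300,0,2) (82,2,2); Pentagon (82,2,3) (300,0,3) (327,0,0);
  Pentagon (180,2,1) (307,0,2) (327,3,2);
  Pentagon (327,3,3) (307,0,3) (180,2,0);
  Pentagon (327,6,1) (311,0,0) (29,2,1); Pentagon (29,2,0) (311,0,1) (327,6,0);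
  Pentagon (327,0,1) (315,0,2) (274,2,3);
  Pentagon (274,2,2) (315,0,3) (327,0,0);
  Pentagon (327,6,1) (316,0,0) (110,2,1);
  Pentagon (110,2,0) (316,0,1) (327,6,0);
  Pentagon (327,3,1) (322,0,2) (240,4,3);
  Pentagon (240,4,2) (322,0,3) (327,3,0);
  Pentagon (327,3,1) (323,0,2) (14,2,1); Pentagon (14,2,0) (323,0,3) (327,3,0);
  Pentagon (168,5,3) (0,0,0) (337,2,3); Pentagon (234,4,2) (0,0,3) (345,6,3);
  Pentagon (227,2,3) (35,0,2) (343,5,1); Pentagon (335,1,2) (36,0,0) (330,4,1);
  Pentagon (242,2,2) (37,0,1) (343,1,1); Pentagon (337,2,2) (41,0,3) (68,2,2);
  Pentagon (169,0,0) (53,0,2) (333,0,3); Pentagon (100,2,2) (62,0,3) (333,3,1);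
  Pentagon (337,5,2) (63,0,2) (241,5,3); Pentagon (337,5,2) (64,0,2) (7,3,2);
  Pentagon (7,3,3) (64,0,3) (337,5,3); Pentagon (49,2,3) (69,0,1) (333,3,1);
  Pentagon (62,4,0) (70,0,2) (337,6,1); Pentagon (48,0,1) (73,0,3) (333,0,3);
  Pentagon (119,4,2) (84,0,2) (337,6,1);
  Pentagon (337,0,0) (100,0,3) (218,6,0);
  Pentagon (281,3,3) (101,0,0) (339,4,1);
  Pentagon (222,3,2) (101,0,1) (341,0,3);
  Pentagon (273,2,3) (103,0,0) (339,3,1);
  Pentagon (333,0,2) (106,0,3) (265,2,3);
  Pentagon (343,6,2) (111,0,3) (292,3,1);
  Pentagon (333,2,0) (117,0,3) (219,2,3);
  Pentagon (331,7,0) (143,0,1) (301,0,3);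
  Pentagon (334,6,0) (176,0,1) (319,7,2);
  Pentagon (345,0,2) (226,0,2) (257,0,1);
  Pentagon (35,7,1) (230,0,2) (345,1,1);
  Pentagon (134,1,2) (232,0,2) (345,1,1);
  Pentagon (172,4,0) (233,0,3) (343,4,3);
  Pentagon (345,6,2) (249,0,2) (289,5,3);
  Pentagon (343,1,0) (255,0,0) (38,0,3);
  Pentagon (196,6,0) (266,0,3) (339,6,3);
  Pentagon (281,6,0) (277,0,2) (341,6,1);
  Pentagon (339,0,0) (282,0,0) (99,7,3); Pentagon (174,5,0) (3,0,0) (356,5,3);
  Pentagon (133,1,2) (39,0,3) (356,1,1); Pentagon (40,6,2) (43,0,1) (356,0,1);
  Pentagon (375,1,3) (48,0,2) (378,5,0); Pentagon (117,7,2) (49,0,0) (359,4,1);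
  Pentagon (59,6,3) (51,0,0) (359,3,1); Pentagon (218,4,3) (70,0,3) (353,4,1);
  Pentagon (190,7,0) (78,0,2) (359,0,3);
  Pentagon (221,1,0) (175,0,2) (357,4,1);
  Pentagon (303,3,0) (305,0,0) (376,2,1); Pentagon (354,5,0) (333,0,2) (358,1,3)].

Lemma certificate_6 : certificate 2 3 triples_6 derivation_6.
Proof. by vm_compute. Qed.
Lemma certificate_7 : certificate 7 1 triples_7 derivation_7.
Proof. by vm_compute. Qed.
Lemma certificate_8 : certificate 8 1 triples_8 derivation_8.
Proof. by vm_compute. Qed.

Theorem theorem5 (R : realType) (k n : nat) (hk : (2 < k)%N) (hkn : (2 * k <= n)%N) :
  finite_type (gr_seed R[i] k n) <->
  (k, n) \in [:: (3, 6); (3, 7); (3, 8)]%N.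
Proof.
split.
  move=> fin; rewrite !inE !xpair_eqE; apply: contraT => neq.
  have [k3|k4] : k = 3 \/ (3 < k)%N by lia.
    by subst k; case: (grid25_infinite (n := n) _ _ fin); lia.
  by case: (grid33_infinite (n := n) k4 _ fin); lia.
rewrite !inE !xpair_eqE => /or3P[] /andP[/eqP -> /eqP ->].
- exact: certificate_finite certificate_6.
- exact: certificate_finite certificate_7.
- exact: certificate_finite certificate_8.
Qed.
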